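(* Let $\{u_n\}_{n\ge 0}$ be any one of the fifteen sporadic sequences $\mathbf{A},\mathbf{B},\mathbf{C},\mathbf{D},\mathbf{E},\mathbf{F},(\delta),(\eta),(\alpha),(\epsilon),(\zeta),(\gamma),s_7,s_{10},s_{18}$ defined below, and let $k=2$ if the sequence is one of $\mathbf{A},\dots,\mathbf{F}$ (these satisfy second-order recurrences/differential equations) and $k=3$ otherwise (these satisfy third-order ones). Then: (i) there is a Laurent polynomial $\Lambda\in\mathbb{Z}[x_1^{\pm1},\dots,x_k^{\pm1}]$ in $k$ variables such that $u_n=\mathrm{CT}(\Lambda^n)$ for every $n\ge 1$; (ii) such a $\Lambda$ (with $u_n=\mathrm{CT}(\Lambda^n)$ for all $n\ge1$) can be chosen so that it factors as a product of Laurent polynomials each of whose coefficients lie in $\{-1,0,1\}$; (iii) if the sequence is not $(\eta)$, such a $\Lambda$ (with integer coefficients and $u_n=\mathrm{CT}(\Lambda^n)$ for all $n\ge1$) can be chosen so that its Newton polytope contains the origin as its only interior integral point.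
   Context: For a Laurent polynomial (or series) $f$, $\mathrm{CT}(f)$ denotes its constant term (the coefficient of $x_1^0\cdots x_d^0$). The Newton polytope of a Laurent polynomial $\sum c_{\mathbf a}x^{\mathbf a}$ is the convex hull in $\mathbb{R}^d$ of $\{\mathbf a\in\mathbb{Z}^d: c_{\mathbf a}\ne0\}$. The sequences are defined by recurrences with $u_{-1}=0$, $u_0=1$: Zagier-type: $(n+1)^2u_{n+1}-(An^2+An+\lambda)u_n+Bn^2u_{n-1}=0$ for $n\ge0$, with $(A,B,\lambda)=(7,-8,2)$ for $\mathbf{A}$, $(9,27,3)$ for $\mathbf{B}$, $(10,9,3)$ for $\mathbf{C}$, $(11,-1,3)$ for $\mathbf{D}$, $(12,32,4)$ for $\mathbf{E}$, $(17,72,6)$ for $\mathbf{F}$. Cooper-type: $(n+1)^3u_{n+1}-(2n+1)(an^2+an+b)u_n+n(cn^2+d)u_{n-1}=0$ for $n\ge0$, with $(a,b,c,d)=(7,3,81,0)$ for $(\delta)$, $(11,5,125,0)$ for $(\eta)$, $(10,4,64,0)$ for $(\alpha)$, $(12,4,16,0)$ for $(\epsilon)$, $(9,3,-27,0)$ for $(\zeta)$, $(17,5,1,0)$ for $(\gamma)$, $(13,4,-27,3)$ for $s_7$, $(6,2,-64,4)$ for $s_{10}$, $(14,6,192,-12)$ for $s_{18}$. (For instance $\mathbf{A}$: $u_n=\sum_k\binom nk^3$; $\mathbf{D}$: $u_n=\sum_k\binom nk^2\binom{n+k}{n}$; $(\gamma)$: $u_n=\sum_k\binom nk^2\binom{n+k}{k}^2$;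 $s_{10}$: $u_n=\sum_k\binom nk^4$.) *)

(* Defs.v *)
From HB Require Import structures.
From mathcomp Require Import all_boot all_order all_algebra.
From mathcomp Require Import finmap monalg.
From mathcomp Require Import all_classical all_reals topology normedtype convex.

Set Implicit Arguments.
Unset Strict Implicit.
Unset Printing Implicit Defensive.

Import Order.TTheory GRing.Theory Num.Theory.
Import numFieldNormedType.Exports.

Local Open Scope classical_set_scope.
Local Open Scope fset_scope.
Local Open Scope ring_scope.

(* Laurent polynomials over int in k variables: finitely supported functions
   from exponent vectors in Z^k to int. The ring structure that monalg puts on
   {malg R[K]} requires the monoid K to have no invertible element but its
   unit, which excludes Z^k; only the additive structure can be reused and the
   convolution product is defined here, over an alias of the type. *)
Definition laurent (k : nat) : Type := {malg int['rV[int]_k]}.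

HB.instance Definition _ (k : nat) := GRing.Zmodule.on (laurent k).

Section LaurentRing.
Context (k : nat).
Implicit Types (f g h : laurent k) (a b : 'rV[int]_k).

Definition lmonom (c : int) a : laurent k := << c *g a >>.

Definition lone : laurent k := lmonom 1 0.

Definition lmul f g : laurent k :=
  \sum_(a <- msupp f) \sum_(b <- msupp g) lmonom (f@_a * g@_b) (a + b).

Let lmonom0 a : lmonom 0 a = 0.
Proof. exact: monalgU0. Qed.

Let lmonomD c d a : lmonom (c + d) a = lmonom c a + lmonom d a.
Proof. exact: monalgUD. Qed.

Let lcoeffD f g a : (f + g)@_a = f@_a + g@_a.
Proof. exact: mcoeffD. Qed.

Let lmulw (d1 d2 : {fset 'rV[int]_k}) f g :
  (msupp f `<=` d1)%fset -> (msupp g `<=` d2)%fset ->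
  lmul f g = \sum_(a <- d1) \sum_(b <- d2) lmonom (f@_a * g@_b) (a + b).
Proof.
move=> le_d1 le_d2; rewrite /lmul (big_fset_incl _ le_d1) /=.
  apply/eq_bigr=> a _; apply/big_fset_incl => // b _ /mcoeff_outdom ->.
  by rewrite mulr0 lmonom0.
move=> a _ /mcoeff_outdom fa.
by rewrite big1 // => b _; rewrite fa mul0r lmonom0.
Qed.

Let lmulC : commutative lmul.
Proof.
move=> f g; rewrite /lmul exchange_big /=; apply/eq_bigr=> a _.
by apply/eq_bigr=> b _; rewrite mulrC addrC.
Qed.

Let lmul0f f : lmul 0 f = 0.
Proof. by rewrite /lmul msupp0 big_seq_fset0. Qed.

Let lmulDl : left_distributive lmul +%R.
Proof.
move=> f g h.
rewrite (lmulw (msuppD_le f g) (fsubset_refl (msupp h))).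
rewrite (lmulw (fsubsetUl (msupp f) (msupp g)) (fsubset_refl (msupp h))).
rewrite (lmulw (fsubsetUr (msupp f) (msupp g)) (fsubset_refl (msupp h))).
rewrite -big_split /=; apply/eq_bigr=> a _.
rewrite -big_split /=; apply/eq_bigr=> b _.
by rewrite lcoeffD mulrDl lmonomD.
Qed.

Let lmulDr : right_distributive lmul +%R.
Proof. by move=> f g h; rewrite lmulC lmulDl !(lmulC f). Qed.

Let lmulf0 f : lmul f 0 = 0.
Proof. by rewrite lmulC lmul0f. Qed.

Let lmulUU c d a b :
  lmul (lmonom c a) (lmonom d b) = lmonom (c * d) (a + b).
Proof.
by rewrite (lmulw msuppU_le msuppU_le) !big_seq_fset1 !mcoeffUU.
Qed.

Let lmul_suml I (r : seq I) (F : I -> laurent k) g :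
  lmul (\sum_(i <- r) F i) g = \sum_(i <- r) lmul (F i) g.
Proof. exact: (big_morph (lmul^~ g) (fun x y => lmulDl x y g) (lmul0f g)). Qed.

Let lmul_sumr I (r : seq I) (F : I -> laurent k) g :
  lmul g (\sum_(i <- r) F i) = \sum_(i <- r) lmul g (F i).
Proof. exact: (big_morph (lmul g) (lmulDr g) (lmulf0 g)). Qed.

Let laurentE f : f = \sum_(a <- msupp f) lmonom f@_a a.
Proof. exact: monalgE. Qed.

Let lmulA : associative lmul.
Proof.
have key r1 r2 r3 (c1 c2 c3 : 'rV[int]_k -> int) :
    lmul (\sum_(a <- r1) lmonom (c1 a) a)
      (lmul (\sum_(a <- r2) lmonom (c2 a) a) (\sum_(a <- r3) lmonom (c3 a) a))
    = lmul (lmul (\sum_(a <- r1) lmonom (c1 a) a)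
      (\sum_(a <- r2) lmonom (c2 a) a)) (\sum_(a <- r3) lmonom (c3 a) a).
  rewrite !lmul_suml; apply/eq_bigr=> a _.
  rewrite !(lmul_sumr r2) lmul_suml; apply/eq_bigr=> b _.
  rewrite !lmul_sumr; apply/eq_bigr=> c _.
  by rewrite !lmulUU mulrA addrA.
move=> f g h; have := key (msupp f) (msupp g) (msupp h)
  (mcoeff^~ f) (mcoeff^~ g) (mcoeff^~ h).
by rewrite -!laurentE.
Qed.

Let lmul1f : left_id lone lmul.
Proof.
move=> f; have key r (c : 'rV[int]_k -> int) :
    lmul lone (\sum_(a <- r) lmonom (c a) a) = \sum_(a <- r) lmonom (c a) a.
  by rewrite lmul_sumr; apply/eq_bigr=> a _; rewrite lmulUU mul1r add0r.
by have := key (msupp f) (mcoeff^~ f); rewrite -!laurentE.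
Qed.

Let lone_neq0 : lone != 0.
Proof. by apply/eqP=> /malgP/(_ 0) /eqP; rewrite mcoeffUU mcoeff0. Qed.

HB.instance Definition _ := GRing.Zmodule_isComNzRing.Build (laurent k)
  lmulA lmulC lmul1f lmulDl lone_neq0.

End LaurentRing.

Definition CT (k : nat) (f : laurent k) : int := f@_(0 : 'rV[int]_k).

Definition newton_polytope (R : realType) (k : nat) (f : laurent k) :
    set 'rV[R]_k :=
  smallest (@convex_set R 'rV[R]_k)
    [set map_mx intr a | a in [set` msupp f]].

Arguments newton_polytope R {k} f.

Definition origin_only_interior_point (R : realType) (k : nat)
    (f : laurent k) : Prop :=
  forall a : 'rV[int]_k,
    (newton_polytope R f)^° (map_mx intr a) <-> a = 0.

Arguments origin_only_interior_point R {k} f.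

Inductive sporadic : Set :=
| seqA | seqB | seqC | seqD | seqE | seqF
| seq_delta | seq_eta | seq_alpha | seq_epsilon | seq_zeta | seq_gamma
| seq_s7 | seq_s10 | seq_s18.

(* u_(n-1), with the convention u_(-1) = 0 *)
Definition prev (u : nat -> rat) (n : nat) : rat :=
  if n is m.+1 then u m else 0.

Definition zagier_seq (A B lam : rat) (u : nat -> rat) : Prop :=
  u 0%N = 1 /\
  forall n : nat,
    (n%:R + 1) ^+ 2 * u n.+1 - (A * n%:R ^+ 2 + A * n%:R + lam) * u n
      + B * n%:R ^+ 2 * prev u n = 0.

Definition cooper_seq (a b c d : rat) (u : nat -> rat) : Prop :=
  u 0%N = 1 /\
  forall n : nat,
    (n%:R + 1) ^+ 3 * u n.+1
      - (2 * n%:R + 1) * (a * n%:R ^+ 2 + a * n%:R + b) * u n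
      + n%:R * (c * n%:R ^+ 2 + d) * prev u n = 0.

Definition is_sporadic (s : sporadic) : (nat -> rat) -> Prop :=
  match s with
  | seqA => zagier_seq 7 (-8) 2
  | seqB => zagier_seq 9 27 3
  | seqC => zagier_seq 10 9 3
  | seqD => zagier_seq 11 (-1) 3
  | seqE => zagier_seq 12 32 4
  | seqF => zagier_seq 17 72 6
  | seq_delta => cooper_seq 7 3 81 0
  | seq_eta => cooper_seq 11 5 125 0
  | seq_alpha => cooper_seq 10 4 64 0
  | seq_epsilon => cooper_seq 12 4 16 0
  | seq_zeta => cooper_seq 9 3 (-27) 0
  | seq_gamma => cooper_seq 17 5 1 0
  | seq_s7 => cooper_seq 13 4 (-27) 3
  | seq_s10 => cooper_seq 6 2 (-64) 4
  | seq_s18 => cooper_seq 14 6 192 (-12)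
  end.

Definition nvars (s : sporadic) : nat :=
  match s with
  | seqA | seqB | seqC | seqD | seqE | seqF => 2
  | _ => 3
  end.

Definition represents (k : nat) (f : laurent k) (u : nat -> rat) : Prop :=
  forall n : nat, (1 <= n)%N -> u n = (CT (f ^+ n))%:~R.

(* Main.v *)
Require Import Defs.
From Stdlib Require Import ZArith.
From mathcomp Require Import all_boot all_order all_algebra.
From mathcomp Require Import finmap monalg.
From mathcomp Require Import ssrZ zify ring lra.
From mathcomp Require Import unstable all_classical all_reals.
From mathcomp Require Import interval_inference topology normedtype convex.

(* Let L be a Laurent polynomial and theta_i the derivation x_i d/dx_i. As
   theta_i(g) never has a constant term, the numbers c_n = CT(L^n) satisfy
     up(n) c_(n+1) - mid(n) c_n + low(n) c_(n-1) = 0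
   as soon as up(n) L^(n+1) - mid(n) L^n + low(n) L^(n-1) is a sum of terms
   theta_i(P_i L^(n-1)), where the P_i are Laurent polynomials whose
   coefficients may depend on n. After division by L^(n-2) this is a polynomial
   identity in n and the x_i. For each of the fifteen sequences a suitable L is
   known as a product of polynomials with coefficients in {-1, 0, 1}, and P_i
   with coefficients polynomial in n, supported in twice the Newton polytope of
   L, are the solutions of a finite system of linear equations.

   Zero is the only interior lattice point of a polytope as soon as the polytope
   contains positive multiples of all e_i and - e_i, and as soon as the integral
   functionals that are at most 1 on it span the dual space positively: such a
   functional cannot take a value >= 1 at an interior point. *)

Set Implicit Arguments.
Unset Strict Implicit.
Unset Printing Implicit Defensive.

Import Order.TTheory GRing.Theory Num.Theory.
Import numFieldNormedType.Exports.
Local Open Scope ring_scope.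

(** * Laurent polynomials *)

(** By the Leibniz rule, theta_i(P_i L^(n-1)) = L^(n-2) (L theta_i(P_i) + (n-1) P_i theta_i(L)).
    This is the origin of the factor L^(n-2), and the reason why the recurrence at n = 0 and n = 1
    is computed separately. The P_i are not derived here, only verified. Every claim about a
    particular L becomes a boolean test on lists of binary integers, run by [vm_compute]; the
    coefficients stay polynomials in n, so one computation settles all n >= 2. The factor up(n) =
    (n+1)^k never vanishes, hence the recurrence and u_0 = 1 determine u, and u_n = CT(L^n) follows
    without any closed formula for u_n. One L serves all the claims about a sequence, with one
    exception: for F the factorization into polynomials with coefficients -1, 0, 1 appears only
    after squaring the variables, which spoils the Newton polytope, so two related polynomials are
    used. *)

Section LaurentModel.
Context (k : nat).
Implicit Types (f g : laurent k) (a b : 'rV[int]_k).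

Definition lcoef f a : int := f@_a.

Lemma lcoef_inj f g : (forall a, lcoef f a = lcoef g a) -> f = g.
Proof. by move=> fg; apply/malgP. Qed.

Lemma lcoefD f g a : lcoef (f + g) a = lcoef f a + lcoef g a.
Proof. exact: mcoeffD. Qed.

Lemma lcoef0 a : lcoef 0 a = 0.
Proof. exact: mcoeff0. Qed.

Lemma lcoef_sum I (r : seq I) (F : I -> laurent k) a :
  lcoef (\sum_(j <- r) F j) a = \sum_(j <- r) lcoef (F j) a.
Proof. by elim/big_rec2: _ => [|j x f _ <-]; rewrite ?lcoef0 ?lcoefD. Qed.

Lemma lcoef_monom c a b : lcoef (lmonom c a) b = c *+ (a == b).
Proof. exact: mcoeffU. Qed.

Lemma laurentE f : f = \sum_(a <- msupp f) lmonom (lcoef f a) a.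
Proof. exact: monalgE. Qed.

Lemma laurent_ind (P : laurent k -> Prop) :
  P 0 -> (forall f g, P f -> P g -> P (f + g)) ->
  (forall c a, P (lmonom c a)) -> forall f, P f.
Proof. by move=> P0 PD Pm f; rewrite (laurentE f); apply: big_ind. Qed.

Lemma lmonom0 a : lmonom 0 a = 0 :> laurent k.
Proof. exact: monalgU0. Qed.

Lemma lmonom1 : lmonom 1 0 = 1 :> laurent k.
Proof. by []. Qed.

Lemma lmonomM c d a b :
  lmonom c a * lmonom d b = lmonom (c * d) (a + b) :> laurent k.
Proof.
(* A monomial with coefficient 0 has empty support, so the convolution sum collapses to one term
   only when c and d are nonzero. *)
have [->|c0] := eqVneq c 0; first by rewrite mul0r !lmonom0 mul0r.
have [->|d0] := eqVneq d 0; first by rewrite mulr0 !lmonom0 mulr0.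
rewrite [LHS]/(lmul _ _) /lmul !msuppU (negPf c0) (negPf d0).
by rewrite !big_seq_fset1 !mcoeffUU.
Qed.

Definition ltheta (i : 'I_k) f : laurent k :=
  \sum_(a <- msupp f) lmonom (lcoef f a * a ord0 i) a.

Lemma lcoef_theta i f a : lcoef (ltheta i f) a = lcoef f a * a ord0 i.
Proof.
rewrite lcoef_sum.
transitivity (\sum_(b <- msupp f) (lcoef f b *+ (b == a)) * a ord0 i).
  apply: eq_bigr => b _; rewrite lcoef_monom.
  by case: eqP => [->|]; rewrite ?mul0r.
rewrite -mulr_suml [in RHS](laurentE f) lcoef_sum; congr (_ * _).
by apply: eq_bigr => b _; rewrite lcoef_monom.
Qed.

End LaurentModel.

(* The proof terms inlined in the ring structure of [laurent k] make rewriting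
   in it intractable, so ring reasoning takes place in an abstract copy. *)
Record laurent_ring (k : nat) := LaurentRing {
  lring :> comNzRingType;
  mono : int -> 'rV[int]_k -> lring;
  coeff : lring -> 'rV[int]_k -> int;
  theta : 'I_k -> lring -> lring;
  coeff_inj : forall f g, (forall a, coeff f a = coeff g a) -> f = g;
  coeffD : forall f g a, coeff (f + g) a = coeff f a + coeff g a;
  coeff_mono : forall c a b, coeff (mono c a) b = c *+ (a == b);
  mono1 : mono 1 0 = 1;
  monoM : forall c d a b, mono c a * mono d b = mono (c * d) (a + b);
  coeff_theta : forall i f a, coeff (theta i f) a = coeff f a * a ord0 i;
  mono_ind : forall P : lring -> Prop,
    P 0 -> (forall f g, P f -> P g -> P (f + g)) ->
    (forall c a, P (mono c a)) -> forall f, P f }.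

Arguments mono {k l} c a.

Definition laurent_model (k : nat) : laurent_ring k :=
  LaurentRing (@lcoef_inj k) (@lcoefD k) (@lcoef_monom k) (@lmonom1 k)
    (@lmonomM k) (@lcoef_theta k) (@laurent_ind k).

(** * Euler derivations and constant terms *)

Section Theta.
Context (k : nat) (M : laurent_ring k).
Implicit Types (f g : M) (a b : 'rV[int]_k) (i : 'I_k).

Lemma coeff0 a : coeff (0 : M) a = 0.
Proof. by apply: (addIr (coeff (0 : M) a)); rewrite add0r -coeffD addr0. Qed.

Lemma mono0 a : mono 0 a = 0 :> M.
Proof. by apply: coeff_inj => b; rewrite coeff_mono coeff0 mul0rn. Qed.

Lemma monoD c d a : mono (c + d) a = mono c a + mono d a :> M.
Proof. by apply: coeff_inj => b; rewrite coeffD !coeff_mono mulrnDl. Qed.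

Lemma theta0 i : theta i (0 : M) = 0.
Proof. by apply: coeff_inj => a; rewrite coeff_theta coeff0 mul0r. Qed.

Lemma thetaD i f g : theta i (f + g) = theta i f + theta i g.
Proof. by apply: coeff_inj => a; rewrite coeffD !coeff_theta coeffD mulrDl. Qed.

Lemma theta_mono i c a : theta i (mono c a : M) = mono (c * a ord0 i) a.
Proof.
apply: coeff_inj => b; rewrite coeff_theta !coeff_mono.
by case: eqP => [->|_]; rewrite ?mul0r.
Qed.

(** Both sides are biadditive in f and g, which leaves monomials; there the Leibniz rule is the
    additivity of exponents. *)
Lemma thetaM i f g : theta i (f * g) = theta i f * g + f * theta i g.
Proof.
elim/mono_ind: f => [|f1 f2 IH1 IH2|c a].
- by rewrite mul0r theta0 !mul0r addr0.
- by rewrite mulrDl !thetaD IH1 IH2 !mulrDl addrACA.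
elim/mono_ind: g => [|g1 g2 IH1 IH2|d b].
- by rewrite mulr0 theta0 !mulr0 addr0.
- by rewrite mulrDr !thetaD IH1 IH2 !mulrDr addrACA.
rewrite monoM !theta_mono !monoM -monoD mxE mulrDr.
by rewrite mulrAC (mulrA c).
Qed.

Lemma thetaX i f n : theta i (f ^+ n.+1) = f ^+ n * theta i f *+ n.+1.
Proof.
elim: n => [|n IHn]; first by rewrite mul1r.
rewrite exprS thetaM IHn [RHS]mulrS [theta i f * _]mulrC; congr (_ + _).
by rewrite -mulrnAr mulrA -exprS mulrnAr.
Qed.

Definition ct f : int := coeff f 0.

Lemma ct_theta i f : ct (theta i f) = 0.
Proof. by rewrite /ct coeff_theta mxE mulr0. Qed.

Lemma ct0 : ct 0 = 0.
Proof. exact: coeff0. Qed.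

Lemma ctD f g : ct (f + g) = ct f + ct g.
Proof. exact: coeffD. Qed.

Lemma ct1 : ct 1 = 1.
Proof. by rewrite /ct -mono1 coeff_mono eqxx. Qed.

(** Scalars, such as the values of up, mid and low at n, enter the ring as constant monomials; this
    takes them out of a constant term. *)
Lemma ctZ c f : ct (mono c 0 * f) = c * ct f.
Proof.
elim/mono_ind: f => [|f1 f2 IH1 IH2|d a].
- by rewrite mulr0 ct0 mulr0.
- by rewrite mulrDr !ctD IH1 IH2 mulrDr.
by rewrite monoM add0r /ct !coeff_mono mulrnAr.
Qed.

End Theta.

(** * Sparse polynomials *)

(** A list over [Z] plays two roles: coefficients of a polynomial in n, lowest degree first, and
    exponent vector. In both, missing entries count as 0, and [addl] is the addition of both. *)
Fixpoint addl (p q : seq Z) : seq Z :=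
  match p, q with
  | a :: p', b :: q' => Z.add a b :: addl p' q'
  | [::], _ => q
  | _, [::] => p
  end.

Definition scall (c : Z) (p : seq Z) : seq Z := map (Z.mul c) p.

Fixpoint mull (p q : seq Z) : seq Z :=
  if p is a :: p' then addl (scall a q) (Z0 :: mull p' q) else [::].

Fixpoint peval (x : int) (p : seq Z) : int :=
  if p is a :: p' then int_of_Z a + x * peval x p' else 0.

Lemma peval_addl x p q : peval x (addl p q) = peval x p + peval x q.
Proof.
elim: p q => [|a p IHp] [|b q] //=; rewrite ?add0r ?addr0 //.
by rewrite IHp (raddfD int_of_Z) mulrDr addrACA.
Qed.

Lemma peval_scall x c p : peval x (scall c p) = int_of_Z c * peval x p.
Proof.
elim: p => [|a p IHp] /=; first by rewrite mulr0.
by rewrite IHp (rmorphM int_of_Z) mulrDr mulrCA.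
Qed.

Lemma peval_mull x p q : peval x (mull p q) = peval x p * peval x q.
Proof.
elim: p => [|a p IHp] /=; first by rewrite mul0r.
by rewrite peval_addl peval_scall /= add0r IHp mulrDl mulrA.
Qed.

Lemma peval_null x p : all (Z.eqb Z0) p -> peval x p = 0.
Proof.
elim: p => // a p IHp /andP[/Z.eqb_spec <- /IHp p0].
by rewrite /= p0 mulr0 addr0.
Qed.

Lemma nth_addl p q j : nth Z0 (addl p q) j = Z.add (nth Z0 p j) (nth Z0 q j).
Proof.
elim: p q j => [|a p IHp] [|b q] [|j] //=; by rewrite ?Z.add_0_r.
Qed.

Definition expo (k : nat) (a : seq Z) : 'rV[int]_k :=
  \row_j int_of_Z (nth Z0 a j).

Lemma expoD k a b : expo k (addl a b) = expo k a + expo k b.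
Proof. by apply/rowP => j; rewrite !mxE nth_addl (raddfD int_of_Z). Qed.

(** Lists that differ only by trailing zeros denote the same exponent vector, so equality of lists
    would be too fine. *)
Definition eqe (k : nat) (a b : seq Z) : bool :=
  all (fun j => Z.eqb (nth Z0 a j) (nth Z0 b j)) (iota 0 k).

Lemma eqeP k a b : eqe k a b = (expo k a == expo k b).
Proof.
apply/allP/eqP => [ab|ab j].
  apply/rowP => j; rewrite !mxE; congr int_of_Z; apply/Z.eqb_spec/ab.
  by rewrite mem_iota add0n /=.
rewrite mem_iota add0n => /= jk.
have := congr1 (fun v : 'rV[int]_k => v ord0 (Ordinal jk)) ab.
by rewrite !mxE /= => /(can_inj int_of_ZK) ->; rewrite Z.eqb_refl.
Qed.

(* A term of a sparse polynomial consists of its exponent vector and of its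
   coefficient, a polynomial in the index n of the recurrence. *)
Definition sparse : Type := seq (seq Z * seq Z).

Fixpoint cmpl (a b : seq Z) : comparison :=
  match a, b with
  | x :: a', y :: b' =>
    match Z.compare x y with Eq => cmpl a' b' | c => c end
  | [::], [::] => Eq
  | [::], _ => Lt
  | _, [::] => Gt
  end.

Lemma cmpl_eq a b : cmpl a b = Eq -> a = b.
Proof.
elim: a b => [|x a IHa] [|y b] //=.
by case: Z.compare_spec => // -> /IHa ->.
Qed.

(* Merging preserves the value whatever the order of the terms; like terms are
   only sure to be collected if both arguments are sorted by [cmpl]. *)
Fixpoint addsp (f : sparse) : sparse -> sparse :=
  fix addsp_f (g : sparse) : sparse :=
    match f, g with
    | [::], _ => g
    | _, [::] => f
    | t :: f', u :: g' =>
      match cmpl t.1 u.1 with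
      | Eq => (t.1, addl t.2 u.2) :: addsp f' g'
      | Lt => t :: addsp f' g
      | Gt => u :: addsp_f g'
      end
    end.

(** Adding a fixed exponent preserves the lexicographic order on lists of equal length, so the
    shifted copies in [mulsp] are again fit for merging. *)
Definition shiftsp (t : seq Z * seq Z) (f : sparse) : sparse :=
  [seq (addl t.1 u.1, mull t.2 u.2) | u <- f].

Definition mulsp (f g : sparse) : sparse :=
  foldr (fun t h => addsp (shiftsp t g) h) [::] f.

(** The empty exponent list is neutral for [addl], whatever the number of variables. *)
Definition onesp : sparse := [:: ([::], [:: Zpos 1])].

Definition prodsp (fs : seq sparse) : sparse := foldr mulsp onesp fs.

Definition thetasp (i : nat) (f : sparse) : sparse :=
  [seq (t.1, scall (nth Z0 t.1 i) t.2) | t <- f].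

(** The coefficients are tested as polynomials in n and not at some value of n, so success gives the
    vanishing for every n at once. *)
Definition nullsp (f : sparse) : bool :=
  all (fun t => all (Z.eqb Z0) t.2) f.

Definition coefsp (k : nat) (a : seq Z) (f : sparse) : seq Z :=
  foldr (fun t p => if eqe k t.1 a then addl t.2 p else p) [::] f.

(** The integer [x] is the value substituted for the index n in the coefficients. *)
Definition laurent_of (k : nat) (M : laurent_ring k) (x : int) (f : sparse) :
    M :=
  \sum_(t <- f) mono (peval x t.2) (expo k t.1).

Section Lev.
Context (k : nat) (M : laurent_ring k) (x : int).
Implicit Types (f g : sparse) (t u : seq Z * seq Z).
Local Notation laurent_of := (laurent_of M x).

Lemma laurent_of_nil : laurent_of [::] = 0.
Proof. exact: big_nil. Qed.

Lemma laurent_of_cons t f :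
  laurent_of (t :: f) = mono (peval x t.2) (expo k t.1) + laurent_of f.
Proof. exact: big_cons. Qed.

Lemma laurent_ofD f g : laurent_of (addsp f g) = laurent_of f + laurent_of g.
Proof.
elim: f g => [|t f IHf]; first by case=> *; rewrite laurent_of_nil add0r.
elim=> [|u g IHg]; first by rewrite laurent_of_nil addr0.
rewrite [addsp _ _]/=; case tu: cmpl.
- rewrite laurent_of_cons IHf !laurent_of_cons peval_addl monoD addrACA.
  by rewrite -(cmpl_eq tu).
- by rewrite laurent_of_cons IHf !laurent_of_cons addrA.
- by rewrite laurent_of_cons IHg (laurent_of_cons u) addrCA.
Qed.

Lemma laurent_of_shift t f :
  laurent_of (shiftsp t f) = mono (peval x t.2) (expo k t.1) * laurent_of f.
Proof.
elim: f => [|u f IHf]; first by rewrite laurent_of_nil mulr0.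
by rewrite !laurent_of_cons IHf mulrDr monoM expoD peval_mull.
Qed.

Lemma laurent_ofM f g : laurent_of (mulsp f g) = laurent_of f * laurent_of g.
Proof.
elim: f => [|t f IHf]; first by rewrite laurent_of_nil mul0r.
by rewrite laurent_ofD laurent_of_shift IHf laurent_of_cons mulrDl.
Qed.

Lemma laurent_of_one : laurent_of onesp = 1.
Proof.
rewrite laurent_of_cons laurent_of_nil addr0 /= mulr0 addr0 -mono1; congr mono.
by apply/rowP => j; rewrite !mxE nth_nil.
Qed.

Lemma laurent_of_prod (fs : seq sparse) :
  laurent_of (prodsp fs) = \prod_(f <- fs) laurent_of f.
Proof.
elim: fs => [|f fs IHfs]; first by rewrite laurent_of_one big_nil.
by rewrite laurent_ofM IHfs big_cons.
Qed.

Lemma laurent_of_theta (i : 'I_k) f :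
  laurent_of (thetasp i f) = theta i (laurent_of f).
Proof.
elim: f => [|t f IHf]; first by rewrite laurent_of_nil theta0.
rewrite !laurent_of_cons IHf thetaD theta_mono; congr (mono _ _ + _).
by rewrite peval_scall mxE mulrC.
Qed.

Lemma laurent_of_null f : nullsp f -> laurent_of f = 0.
Proof.
elim: f => [|t f IHf] /=; first by rewrite laurent_of_nil.
case/andP=> /(peval_null x) t0 /IHf f0.
by rewrite laurent_of_cons t0 f0 mono0 addr0.
Qed.

Lemma coeff_laurent_of a f :
  coeff (laurent_of f) (expo k a) = peval x (coefsp k a f).
Proof.
elim: f => [|t f IHf] /=; first by rewrite laurent_of_nil coeff0.
rewrite laurent_of_cons coeffD coeff_mono IHf eqeP; case: ifP => _.
- by rewrite peval_addl.
- by rewrite mulr0n add0r.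
Qed.

End Lev.

(** * Recurrences for constant terms *)

Record recurrence := Recurrence { up : seq Z; mid : seq Z; low : seq Z }.

Definition satisfies (r : recurrence) (c : nat -> int) : Prop :=
  forall n : nat,
    peval n (up r) * c n.+1 - peval n (mid r) * c n
      + peval n (low r) * (if n is m.+1 then c m else 0) = 0.

(** All k zeros are written out, since [cmpl] would not identify the empty list with the exponent of
    a constant term of L when merging. *)
Definition constsp (k : nat) (p : seq Z) : sparse := [:: (nseq k Z0, p)].

Definition recurrence_op (k : nat) (r : recurrence) (L : sparse) : sparse :=
  addsp (mulsp (addsp (mulsp (constsp k (up r)) L)
                      (constsp k (scall (Zneg 1) (mid r)))) L)
        (constsp k (low r)).

(** The recurrence at n = 0 and n = 1 with c_0 = 1, the two instances in which L^(n-2) is a negative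
    power. *)
Definition initial_check (k : nat) (r : recurrence) (L : sparse) : bool :=
  let c1 := peval 0 (coefsp k [::] L) in
  let c2 := peval 0 (coefsp k [::] (mulsp L L)) in
  (peval 0 (up r) * c1 - peval 0 (mid r) == 0)
  && (peval 1 (up r) * c2 - peval 1 (mid r) * c1 + peval 1 (low r) == 0).

(* With n as the variable of the coefficient lists, [certificate] asserts
     L (D (up L^2 - mid L + low) - sum_i theta_i(P_i))
       = (n - 1) sum_i P_i theta_i(L);
   multiplied by L^(n-2), the terms with the P_i become theta_i(P_i L^(n-1)). *)
Definition certificate (k : nat) (r : recurrence) (L : sparse) (D : Z)
    (P : seq sparse) : bool :=
  let E := foldr (fun i => addsp (thetasp i (nth [::] P i))) [::] (iota 0 k) in
  let F := foldr (fun i => addsp (mulsp (thetasp i L)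
             (mulsp (constsp k [:: Zneg 1; Zpos 1]) (nth [::] P i)))) [::]
             (iota 0 k) in
  let T := addsp (mulsp (constsp k [:: D]) (recurrence_op k r L))
                 (mulsp (constsp k [:: Zneg 1]) E) in
  nullsp (addsp (mulsp L T) (mulsp (constsp k [:: Zneg 1]) F)).

Definition scalarsp (f : sparse) : bool := all (fun t => size t.2 <= 1)%N f.

Section Certificate.
Context (k : nat) (M : laurent_ring k).

Lemma laurent_of_scalar x y f :
  scalarsp f -> laurent_of M x f = laurent_of M y f.
Proof.
elim: f => [|t f IHf]; first by rewrite !laurent_of_nil.
case/andP=> t1 /IHf f1; rewrite !laurent_of_cons f1; congr (mono _ _ + _).
by case: t.2 t1 => [|a []] //=; rewrite !mulr0.
Qed.

Lemma laurent_of_const x p : laurent_of M x (constsp k p) = mono (peval x p) 0.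
Proof.
rewrite laurent_of_cons laurent_of_nil addr0; congr mono.
by apply/rowP => j; rewrite !mxE nth_nseq if_same.
Qed.

Lemma laurent_of_sum_ord x (G : nat -> sparse) n :
  laurent_of M x (foldr (fun i => addsp (G i)) [::] (iota 0 n))
  = \sum_(i < n) laurent_of M x (G i).
Proof.
rewrite -(big_mkord xpredT (fun i => laurent_of M x (G i))) /index_iota subn0.
elim: (iota 0 n) => [|i s IHs] /=; first by rewrite big_nil laurent_of_nil.
by rewrite laurent_ofD IHs big_cons.
Qed.

Lemma mono_natl n (f : M) : mono n%:Z 0 * f = f *+ n.
Proof.
elim: n => [|n IHn]; first by rewrite mono0 mul0r.
by rewrite mulrS -IHn -addn1 PoszD addrC monoD mono1 mulrDl mul1r.
Qed.

Lemma monoN c (a : 'rV[int]_k) : mono (- c) a = - mono c a :> M.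
Proof. by apply: (addIr (mono c a)); rewrite -monoD !addNr mono0. Qed.

(** The certificate yields D times the recurrence, where D makes integral P_i possible; as the
    constant terms are integers, D <> 0 can be cancelled at the end. *)
Theorem ct_exp_recurrence r L D P :
    D <> Z0 -> scalarsp L -> initial_check k r L -> certificate k r L D P ->
  satisfies r (fun n => ct (laurent_of M 0 L ^+ n)).
Proof.
move=> D0 Lscal /andP[/eqP init0 /eqP init1] cert n.
have c1E : ct (laurent_of M 0 L) = peval 0 (coefsp k [::] L).
  rewrite -(coeff_laurent_of M); congr coeff.
  by apply/rowP => j; rewrite !mxE nth_nil.
have c2E : ct (laurent_of M 0 L ^+ 2) = peval 0 (coefsp k [::] (mulsp L L)).
  rewrite -(coeff_laurent_of M) laurent_ofM; congr coeff.
  by apply/rowP => j; rewrite !mxE nth_nil.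
case: n => [|[|m]].
- by rewrite expr0 expr1 ct1 c1E !mulr1 mulr0 addr0.
- by rewrite expr0 expr1 ct1 c1E c2E mulr1.
(* From here on n = m + 2: [x] is the value of n, X^m is L^(n-2), and m + 1 is n - 1. *)
set X := laurent_of M 0 L; set x : int := m.+2.
have XE : laurent_of M x L = X by exact: laurent_of_scalar.
pose p (i : 'I_k) := laurent_of M x (nth [::] P i).
pose R : M := (mono (peval x (up r)) 0 * X - mono (peval x (mid r)) 0) * X
  + mono (peval x (low r)) 0.
have RE : laurent_of M x (recurrence_op k r L) = R.
  rewrite laurent_ofD laurent_ofM laurent_ofD laurent_ofM !laurent_of_const XE.
  by rewrite peval_scall mulN1r monoN.
have opp1 (f : M) : mono (peval x [:: Zneg 1]) 0 * f = - f.
  have -> : peval x [:: Zneg 1] = -1 by rewrite /= mulr0.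
  by rewrite monoN mono1 mulN1r.
have shift1 : peval x [:: Zneg 1; Zpos 1] = m.+1.
  by rewrite /= mulr0 addr0 mulr1 /x; lia.
(* This is the certificate with n specialized to m + 2. *)
have key : X * (mono (int_of_Z D) 0 * R - \sum_i theta i (p i))
    = \sum_i (theta i X * p i *+ m.+1).
  apply: subr0_eq; rewrite -[RHS](laurent_of_null M x cert).
  rewrite laurent_ofD laurent_ofM laurent_ofD laurent_ofM RE !laurent_of_const.
  rewrite XE laurent_ofM laurent_ofM !laurent_of_const !opp1.
  have -> : peval x [:: D] = int_of_Z D by rewrite /= mulr0 addr0.
  rewrite !laurent_of_sum_ord; congr (_ * (_ - _) - _).
    by apply: eq_bigr => i _; rewrite laurent_of_theta.
  apply: eq_bigr => i _; rewrite laurent_ofM laurent_ofM.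
  by rewrite laurent_of_const shift1 mono_natl laurent_of_theta XE mulrnAr.
(* After multiplication of [key] by X^m, the terms theta_i(p_i) X^(m+1) and (m+1) p_i X^m theta_i(X)
   combine by the Leibniz rule. *)
have tele : mono (int_of_Z D) 0 * (R * X ^+ m.+1)
    = \sum_i theta i (p i * X ^+ m.+1).
  transitivity (X ^+ m * (X * (mono (int_of_Z D) 0 * R))).
    by rewrite [RHS]mulrA -exprSr [RHS]mulrCA (mulrC R).
  have -> : X * (mono (int_of_Z D) 0 * R)
      = X * (\sum_i theta i (p i)) + \sum_i (theta i X * p i *+ m.+1).
    by rewrite -key mulrBr addrC subrK.
  rewrite mulrDr mulr_sumr !mulr_sumr -big_split.
  apply: eq_bigr => i _; rewrite thetaM thetaX; congr (_ + _).
    by rewrite mulrA -exprSr mulrC.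
  by rewrite !mulrnAr mulrA mulrC.
have : int_of_Z D * ct (R * X ^+ m.+1) = 0.
  rewrite -ctZ tele.
  elim/big_rec: _ => [|i f _ IHf]; first exact: ct0.
  by rewrite ctD ct_theta IHf addr0.
move/eqP; rewrite mulf_eq0 => /orP[/eqP /(can_inj int_of_ZK (x2 := Z0))//|].
have -> : R * X ^+ m.+1 = mono (peval x (up r)) 0 * X ^+ m.+3
    + mono (- peval x (mid r)) 0 * X ^+ m.+2
    + mono (peval x (low r)) 0 * X ^+ m.+1.
  by rewrite mulrDl -mulrA -exprS mulrBl -mulrA -exprS monoN mulNr.
by rewrite !ctD !ctZ mulNr => /eqP.
Qed.
End Certificate.

(** * Uniqueness of the solution, and the fifteen recurrences *)

Definition rat_satisfies (r : recurrence) (u : nat -> rat) : Prop :=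
  forall n : nat,
    (peval n (up r))%:~R * u n.+1 - (peval n (mid r))%:~R * u n
      + (peval n (low r))%:~R * Defs.prev u n = 0.

(** Division by up(n) expresses each term by the two before it. One initial value suffices, because
    the term of index -1 is 0 in both recurrences. *)
Lemma satisfies_unique r (u : nat -> rat) (c : nat -> int) :
    (forall n : nat, peval n (up r) != 0) ->
    u 0%N = 1 -> rat_satisfies r u -> c 0%N = 1 -> satisfies r c ->
  forall n, u n = (c n)%:~R.
Proof.
move=> up0 u0 ru c0 rc n.
(* The recurrence has order two, so the induction carries two consecutive terms. *)
suff: u n = (c n)%:~R /\ u n.+1 = (c n.+1)%:~R by case.
have step m : u m = (c m)%:~R ->
    Defs.prev u m = (if m is m'.+1 then c m' else 0)%:~R ->
    u m.+1 = (c m.+1)%:~R.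
  move=> um upm; have := ru m; have /(congr1 (intr : int -> rat)) := rc m.
  rewrite um upm rmorphD rmorphB !rmorphM /= rmorph0 => <-.
  by move/addIr/addIr/mulfI; apply; rewrite intr_eq0.
elim: n => [|n [IHn IHSn]].
  by split; [rewrite u0 c0 | apply: step; rewrite ?u0 ?c0].
by split=> //; apply: step.
Qed.

Section Recurrences.
Local Open Scope Z_scope.

Definition zagier_recurrence (A B lam : Z) : recurrence :=
  Recurrence [:: 1; 2; 1] [:: lam; A; A] [:: 0; 0; B].

Definition cooper_recurrence (a b c d : Z) : recurrence :=
  Recurrence [:: 1; 3; 3; 1] (mull [:: 1; 2] [:: b; a; a]) [:: 0; d; 0; c].

Definition sporadic_recurrence (s : sporadic) : recurrence :=
  match s with
  | seqA => zagier_recurrence 7 (-8) 2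
  | seqB => zagier_recurrence 9 27 3
  | seqC => zagier_recurrence 10 9 3
  | seqD => zagier_recurrence 11 (-1) 3
  | seqE => zagier_recurrence 12 32 4
  | seqF => zagier_recurrence 17 72 6
  | seq_delta => cooper_recurrence 7 3 81 0
  | seq_eta => cooper_recurrence 11 5 125 0
  | seq_alpha => cooper_recurrence 10 4 64 0
  | seq_epsilon => cooper_recurrence 12 4 16 0
  | seq_zeta => cooper_recurrence 9 3 (-27) 0
  | seq_gamma => cooper_recurrence 17 5 1 0
  | seq_s7 => cooper_recurrence 13 4 (-27) 3
  | seq_s10 => cooper_recurrence 6 2 (-64) 4
  | seq_s18 => cooper_recurrence 14 6 192 (-12)
  end.

End Recurrences.

Local Notation toQ z := ((int_of_Z z)%:~R : rat).

Lemma zagier_rat_satisfies A B lam a b l u :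
  a = toQ A -> b = toQ B -> l = toQ lam -> zagier_seq a b l u ->
  rat_satisfies (zagier_recurrence A B lam) u.
Proof.
move=> -> -> -> [_ ru] n; rewrite -[RHS](ru n) /=.
rewrite !(rmorphD, rmorphM, rmorph0) /= !rmorph1.
by rewrite -!pmulrn (_ : Pos.to_nat 2 = 2%N) //; ring.
Qed.

Lemma cooper_rat_satisfies a b c d a' b' c' d' u :
  a' = toQ a -> b' = toQ b -> c' = toQ c -> d' = toQ d ->
  cooper_seq a' b' c' d' u -> rat_satisfies (cooper_recurrence a b c d) u.
Proof.
move=> -> -> -> -> [_ ru] n; rewrite -[RHS](ru n) peval_mull /=.
rewrite !(rmorphD, rmorphM, rmorph0) /= !rmorph1.
rewrite -!pmulrn (_ : Pos.to_nat 2 = 2%N) // (_ : Pos.to_nat 3 = 3%N) //.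
by ring.
Qed.

Lemma sporadic_rat_satisfies s u :
  is_sporadic s u -> u 0%N = 1 /\ rat_satisfies (sporadic_recurrence s) u.
Proof.
move=> su; split; first by case: s su => -[].
case: s su => /=; match goal with
  | |- zagier_seq _ _ _ _ -> _ => apply: zagier_rat_satisfies
  | |- cooper_seq _ _ _ _ _ -> _ => apply: cooper_rat_satisfies
  end; rewrite /= ?NegzE ?mulrNz -?pmulrn //.
Qed.

Lemma sporadic_up_neq0 s (n : nat) : peval n (up (sporadic_recurrence s)) != 0.
Proof. by case: s => /=; lia. Qed.

(** * Newton polytopes *)

Section Convex.
Local Open Scope classical_set_scope.
Context (R : realType) (k : nat).
Implicit Types (A : set 'rV[R]_k) (x y : 'rV[R]_k).

Lemma convex_segment A x y (t : R) :
  @convex_set R 'rV[R]_k A -> A x -> A y -> 0 <= t <= 1 ->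
  A (t *: x + (1 - t) *: y).
Proof.
move=> cA Ax Ay /andP[t0 t1].
by have := cA x y (Itv01 t0 t1) (mem_set Ax) (mem_set Ay) => /set_mem.
Qed.

(** The mean of x :: s is a convex combination of x, with weight the inverse of the new length, and
    of the mean of s. *)
Lemma convex_mean A (s : seq 'rV[R]_k) :
  @convex_set R 'rV[R]_k A -> s != [::] -> (forall x, x \in s -> A x) ->
  A ((size s)%:R^-1 *: \sum_(x <- s) x).
Proof.
move=> cA; elim: s => // x s IHs _ sA.
have [->|s0] := eqVneq s [::].
  by rewrite big_seq1 invr1 scale1r; apply: sA; rewrite mem_head.
have As : A ((size s)%:R^-1 *: \sum_(y <- s) y).
  by apply: IHs => // y ys; apply: sA; rewrite in_cons ys orbT.
have n0 : (size s)%:R != 0 :> R by rewrite pnatr_eq0 size_eq0.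
have n1 : 1 + (size s)%:R != 0 :> R by rewrite -mulrS pnatr_eq0.
have Ax : A x by apply: sA; rewrite mem_head.
have t01 : 0 <= ((size (x :: s))%:R^-1 : R) <= 1.
  apply/andP; split; first by rewrite invr_ge0 ler0n.
  by rewrite invf_le1 ?ler1n ?ltr0n.
have := convex_segment cA Ax As t01.
rewrite big_cons scalerDr scalerA /= mulrS.
suff -> : (1 - (1 + (size s)%:R)^-1) * (size s)%:R^-1
    = (1 + (size s)%:R)^-1 :> R by [].
by field; rewrite n0 n1.
Qed.

Lemma convex_halfspace (l : 'rV[R]_k) (h : R) :
  @convex_set R 'rV[R]_k [set x | \sum_j l ord0 j * x ord0 j <= h].
Proof.
move=> x y t /set_mem /= hx /set_mem /= hy; apply/mem_set => /=.
have -> : \sum_j l ord0 j * (conv t x y : 'rV[R]_k) ord0 j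
    = t%:num * (\sum_j l ord0 j * x ord0 j)
      + (1 - t%:num) * (\sum_j l ord0 j * y ord0 j).
  rewrite !mulr_sumr -big_split; apply: eq_bigr => j _ /=.
  by rewrite !mxE /onem; ring.
have t0 : 0 <= t%:num :> R by [].
have t1 : t%:num <= 1 :> R by [].
nra.
Qed.

Lemma interior_scale A x :
  interior A x -> exists2 e : R, 0 < e & A ((1 + e) *: x).
Proof.
rewrite /interior => /nbhs_ballP[e /= e0 eA].
have x0 : 0 < 1 + `|x| by rewrite ltr_wpDr.
(* The dilation moves x by e |x| / (2 (1 + |x|)) < e; the summand 1 keeps the denominator positive
   when x = 0. *)
exists (e / (2 * (1 + `|x|))); first by rewrite divr_gt0 // mulr_gt0.
apply: eA; rewrite -ball_normE /= scalerDl scale1r opprD addNKr normrN normrZ.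
rewrite ger0_norm; last by rewrite divr_ge0 ?mulr_ge0 ?ltW.
rewrite mulrAC ltr_pdivrMr ?mulr_gt0 // ltr_pM2l //.
by move: x0; lra.
Qed.

(** A vector y is the mean of the k points k y_i e_i. They lie on the given segments of the axes
    once every |y_i| is at most r / k, so the ball of radius r / k is contained in A. *)
Lemma interior_cross A (r : R) : (0 < k)%N -> 0 < r ->
    @convex_set R 'rV[R]_k A ->
    (forall (i : 'I_k) (t : R), `|t| <= r -> A (t *: delta_mx ord0 i)) ->
  interior A 0.
Proof.
move=> k0 r0 cA axis; rewrite /interior; apply/nbhs_ballP.
have kR : 0 < k%:R :> R by rewrite ltr0n.
exists (r / k%:R); first by rewrite /= divr_gt0.
move=> y /= y_ball.
pose s := [seq k%:R * y ord0 i *: delta_mx ord0 i : 'rV[R]_k | i <- enum 'I_k].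
have sz : size s = k by rewrite size_map size_enum_ord.
have -> : y = (size s)%:R^-1 *: \sum_(x <- s) x.
  rewrite sz big_map big_enum /= scaler_sumr {1}(row_sum_delta y).
  by apply: eq_bigr => i _; rewrite scalerA mulrA mulVf ?mul1r // gt_eqF.
apply: convex_mean => //; first by rewrite -size_eq0 sz -lt0n.
move=> x /mapP[i _ ->]; apply: axis.
have := y_ball.2 ord0 i; rewrite -ball_normE /= mxE sub0r normrN => yi.
by rewrite normrM normr_nat mulrC -ler_pdivlMr // ltW.
Qed.

End Convex.

Section Polytope.
Local Open Scope classical_set_scope.
Context (R : realType) (k : nat) (f : laurent k).
Local Notation P := (newton_polytope R f).
Local Notation inj a := (map_mx intr a : 'rV[R]_k).

Lemma newton_convex : @convex_set R 'rV[R]_k P.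
Proof.
move=> x y t /set_mem Px /set_mem Py; apply/mem_set => A [cA fA].
by apply/set_mem/cA; apply/mem_set; [exact: Px | exact: Py].
Qed.

Lemma newton_support a : f@_a != 0 -> P (inj a).
Proof.
by move=> fa; apply: sub_gen_smallest; exists a => //=; rewrite -mcoeff_neq0.
Qed.

(** A half-space is convex, so it contains the hull as soon as it contains the support. *)
Lemma newton_halfspace (l : 'rV[int]_k) (h : int) :
    (forall a, f@_a != 0 -> \sum_j l ord0 j * a ord0 j <= h) ->
  forall x, P x -> \sum_j (inj l) ord0 j * x ord0 j <= h%:~R.
Proof.
move=> lh x Px.
suff: P `<=` [set x | \sum_j (inj l) ord0 j * x ord0 j <= h%:~R] by apply.
apply: smallest_sub; first exact: convex_halfspace.
move=> _ [a /= af <-]; rewrite -mcoeff_neq0 in af.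
rewrite (eq_bigr (fun j => (l ord0 j * a ord0 j)%:~R)).
  by rewrite -rmorph_sum ler_int; exact: lh.
by move=> j _; rewrite !mxE intrM.
Qed.

(* A lattice point satisfying [l a >= 1] for some [l <= 1] on the polytope is
   not interior, because a slight dilation of it would violate [l <= 1]. *)
Lemma interior_lattice_le0 (l a : 'rV[int]_k) :
    (forall b, f@_b != 0 -> \sum_j l ord0 j * b ord0 j <= 1) ->
  interior P (inj a) -> \sum_j l ord0 j * a ord0 j <= 0.
Proof.
move=> l1 /interior_scale[e e0 /(newton_halfspace l1)].
rewrite (eq_bigr (fun j => (1 + e) * (l ord0 j * a ord0 j)%:~R)); last first.
  by move=> j _; rewrite !mxE intrM mulrCA.
rewrite -mulr_sumr -rmorph_sum /=; move: (\sum_j _) => z ez.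
rewrite leNgt; apply/negP; rewrite gtz0_ge1 -(ler_int R) => z1; nra.
Qed.

End Polytope.

(** * A computable criterion for the origin as only interior lattice point *)

Definition dotl (k : nat) (a b : seq Z) : Z :=
  foldr (fun j => Z.add (Z.mul (nth Z0 a j) (nth Z0 b j))) Z0 (iota 0 k).

Lemma int_of_dotl k a b :
  int_of_Z (dotl k a b) = \sum_j expo k a ord0 j * expo k b ord0 j.
Proof.
pose t j := int_of_Z (Z.mul (nth Z0 a j) (nth Z0 b j)).
rewrite (eq_bigr (fun j : 'I_k => t j)).
  rewrite -(big_mkord xpredT t).
  rewrite /index_iota subn0 /dotl; elim: (iota 0 k) => [|j s IHs].
    by rewrite big_nil.
  by rewrite big_cons -IHs -(raddfD int_of_Z).
by move=> j _; rewrite !mxE /t (rmorphM int_of_Z).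
Qed.

Lemma int_of_Z_gt0 z : Z.ltb Z0 z -> 0 < int_of_Z z.
Proof.
by case: z => // p _; rewrite ltz_nat; apply/ssrnat.ltP/Pos2Nat.is_pos.
Qed.

Lemma int_of_Z_le1 z : Z.leb z (Zpos 1) -> int_of_Z z <= 1.
Proof. by case: z => // -[p|p|]. Qed.

(** The sign of c, which is 1 or -1 in use, selects the half-axis. The inequality is strict, so the
    empty list, the default of [nth], fails. *)
Definition axis (k i : nat) (c : Z) (s : seq (seq Z)) : bool :=
  let v := foldr addl [::] s in
  Z.ltb Z0 (Z.mul c (nth Z0 v i))
  && all (fun j => (j == i) || Z.eqb (nth Z0 v j) Z0) (iota 0 k).

Lemma axisP k (i : 'I_k) c s : axis k i c s ->
  exists2 m : int, 0 < int_of_Z c * m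
    & \sum_(a <- s) expo k a = m *: delta_mx ord0 i.
Proof.
have -> : \sum_(a <- s) expo k a = expo k (foldr addl [::] s).
  elim: s => [|a s IHs] /=; last by rewrite big_cons IHs expoD.
  by rewrite big_nil; apply/rowP => j; rewrite !mxE nth_nil.
rewrite /axis; move: (foldr _ _ _) => v /andP[cv /allP v0].
exists (int_of_Z (nth Z0 v i)).
  by rewrite -(rmorphM int_of_Z); exact: int_of_Z_gt0.
apply/rowP => j; rewrite !mxE eqxx /=; have := v0 j.
rewrite mem_iota /= add0n ltn_ord => /(_ isT) /orP[/eqP/val_inj -> |].
  by rewrite eqxx mulr1.
move/Z.eqb_spec => vj; have [ij|_] := eqVneq j i; last by rewrite vj mulr0.
by rewrite ij mulr1.
Qed.

(** Layout of V: k lists for the e_i, then k lists for the - e_i. *)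
Definition axes (k : nat) (V : seq (seq (seq Z))) : bool :=
  all (fun i => axis k i (Zpos 1) (nth [::] V i)
             && axis k i (Zneg 1) (nth [::] V (k + i))) (iota 0 k).

Definition support_point (k : nat) (L : sparse) (a : seq Z) : bool :=
  if coefsp k a L is [:: c] then ~~ Z.eqb c Z0 else false.

Definition support_bound (k : nat) (L : sparse) (l : seq Z) : bool :=
  all (fun t => Z.leb (dotl k l t.1) (Zpos 1)) L.

(* The lists in [V] consist of points of the polytope and those in [H] of
   functionals that are at most 1 on it; their sums are positive multiples of
   the vectors e_i and - e_i. *)
Definition polytope_check (k : nat) (L : sparse) (V H : seq (seq (seq Z))) :
    bool :=
  [&& axes k V, all (all (support_point k L)) V,
      axes k H & all (all (support_bound k L)) H].

Lemma laurent_of_support k (M : laurent_ring k) x L a :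
  coeff (laurent_of M x L) a != 0 -> exists2 t, t \in L & expo k t.1 = a.
Proof.
elim: L => [|t L IHL]; first by rewrite laurent_of_nil coeff0 eqxx.
rewrite laurent_of_cons coeffD coeff_mono; case: (expo k t.1 =P a) => [<- _|_].
  by exists t; rewrite ?mem_head.
by rewrite add0r => /IHL[u uL <-]; exists u => //; rewrite in_cons uL orbT.
Qed.

Lemma convex_axis (R : realType) (k : nat) (A : set 'rV[R]_k) (x : 'rV[R]_k)
    (p q t : R) :
    @convex_set R 'rV[R]_k A -> A (p *: x) -> A (q *: x) -> q < p ->
  q <= t <= p -> A (t *: x).
Proof.
move=> cA Ap Aq qp /andP[qt tp].
have pq : 0 < p - q by rewrite subr_gt0.
have l01 : 0 <= (t - q) / (p - q) <= 1.
  apply/andP; split; first by rewrite divr_ge0 ?subr_ge0 // ltW.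
  by rewrite ler_pdivrMr // mul1r lerD2r.
have := convex_segment cA Ap Aq l01; rewrite !scalerA -scalerDl.
suff -> : (t - q) / (p - q) * p + (1 - (t - q) / (p - q)) * q = t by [].
by field; rewrite gt_eqF.
Qed.

Lemma all_all_nth (T : Type) (P : pred T) (V : seq (seq T)) i :
  all (all P) V -> all P (nth [::] V i).
Proof. by elim: V i => [|s V IHV] [|i] //= /andP[sP /IHV]; auto. Qed.

(** One bound for all the list lengths gives one radius valid on all the axes. *)
Lemma size_nth_le (T : Type) (V : seq (seq T)) i :
  (size (nth [::] V i) <= sumn (map size V))%N.
Proof.
elim: V i => [|s V IHV] [|i] //=; first exact: leq_addr.
exact: leq_trans (IHV i) (leq_addl _ _).
Qed.

Theorem polytope_checkP (R : realType) k L V H :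
  (0 < k)%N -> polytope_check k L V H ->
  origin_only_interior_point R (laurent_of (laurent_model k) 0 L : laurent k).
Proof.
move=> k0 /and4P[/allP Vaxes Vsupp /allP Haxes Hbound] a.
set f : laurent k := laurent_of (laurent_model k) 0 L.
have sub (i : 'I_k) : (i : nat) \in iota 0 k.
  by rewrite mem_iota add0n /=.
split=> [a_int|->].
  apply/rowP => i; rewrite [RHS]mxE.
  (* The bounds l a <= 0 for the functionals l in s add up to m a_i <= 0, where m has the sign of c.
     Both signs together force a_i = 0. *)
  have bound c s : all (support_bound k L) s -> axis k i c s ->
      int_of_Z c * a ord0 i <= 0.
    move=> /allP sH /axisP[m cm mE].
    have : \sum_(l <- s) \sum_j expo k l ord0 j * a ord0 j <= 0.
      rewrite big_seq; apply: sumr_le0 => l /sH/allP lL.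
      apply: interior_lattice_le0 a_int => b.
      rewrite -[f@_b]/(coeff (l := laurent_model k) f b).
      move=> /laurent_of_support[t /lL tl <-]; rewrite -int_of_dotl.
      exact: int_of_Z_le1.
    rewrite exchange_big /= (eq_bigr (fun j => m * (j == i)%:R * a ord0 j)).
      rewrite (bigD1 i) //= eqxx mulr1 big1 ?addr0 => [|j /negPf->]; last first.
        by rewrite mulr0 mul0r.
      by move: cm; nia.
    by move=> j _; rewrite -mulr_suml -[X in X * _](summxE) mE !mxE eqxx.
  have /andP[ax1 ax2] := Haxes _ (sub i).
  have := bound _ _ (all_all_nth _ Hbound) ax1; rewrite mul1r => a_le0.
  have := bound _ _ (all_all_nth _ Hbound) ax2.
  rewrite mulN1r oppr_le0 => a_ge0.
  by apply/eqP; rewrite eq_le a_le0.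
rewrite (_ : map_mx intr 0 = 0); last by apply/rowP => j; rewrite !mxE.
(* This exceeds every list length, so the mean of each list, (m / size s) e_i with m a nonzero
   integer, is at distance at least 1/n from 0. *)
pose n := (sumn (map size V)).+1.
have vert c j (i : 'I_k) : axis k i c (nth [::] V j) ->
    exists m : R, [/\ newton_polytope R f (m *: delta_mx ord0 i)
      & n%:R^-1 <= (int_of_Z c)%:~R * m].
  move=> /axisP[m cm mE]; set s := nth [::] V j in mE *.
  have s0 : s != [::].
    apply: contraTneq cm => s0; move: mE; rewrite s0 big_nil.
    move/(congr1 (fun v : 'rV[int]_k => v ord0 i)).
    by rewrite !mxE !eqxx mulr1 => <-; rewrite mulr0 ltxx.
  have sz0 : 0 < (size s)%:R :> R by rewrite ltr0n lt0n size_eq0.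
  exists (m%:~R / (size s)%:R); split.
    pose S := [seq map_mx intr (expo k v) : 'rV[R]_k | v <- s].
    have SE : \sum_(x <- S) x = m%:~R *: delta_mx ord0 i.
      rewrite big_map; apply/rowP => l; rewrite summxE.
      rewrite (eq_bigr (fun v => (expo k v ord0 l)%:~R)).
        by rewrite -rmorph_sum /= -summxE mE !mxE intrM eqxx; case: (l == i).
      by move=> v _; rewrite mxE.
    rewrite mulrC -scalerA -SE.
    rewrite -(size_map (fun v => map_mx intr (expo k v) : 'rV[R]_k)).
    apply: convex_mean; first exact: newton_convex.
      by rewrite -size_eq0 size_map size_eq0.
    move=> _ /mapP[v vs ->]; apply: newton_support.
    have /allP/(_ v vs) := all_all_nth j Vsupp.
    rewrite -[f@_ _]/(coeff (l := laurent_model k) f (expo k v)).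
    rewrite coeff_laurent_of /support_point; case: coefsp => [//|z [|//]].
    rewrite /= mul0r addr0; apply: contraNneq => z0.
    by rewrite (can_inj int_of_ZK (x2 := Z0) z0).
  (* What remains is size s <= n c m up to the order of factors, where c m is a positive integer. *)
  rewrite mulrA -intrM ler_pdivlMr // mulrC ler_pdivrMr ?ltr0n //.
  apply: (@le_trans _ _ n%:R).
    by rewrite ler_nat ltnW // ltnS size_nth_le.
  by rewrite ler_peMl ?ler0n // ler1z -gtz0_ge1.
apply: (@interior_cross _ _ _ n%:R^-1) => //; first by rewrite invr_gt0 ltr0n.
  exact: newton_convex.
move=> i t; rewrite ler_norml => /andP[t1 t2].
(* Here p >= 1/n and q <= -1/n, so the segment from q e_i to p e_i contains t e_i. *)
have /andP[/vert[p [Pp np]] /vert[q [Pq nq]]] := Vaxes _ (sub i).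
have n0 : 0 < n%:R^-1 :> R by rewrite invr_gt0 ltr0n.
rewrite /= mul1r in np; rewrite /= mulN1r in nq.
apply: (convex_axis (@newton_convex R k f) Pp Pq); first by lra.
by apply/andP; split; lra.
Qed.

(** * The fifteen sequences *)

Definition oppsp (f : sparse) : sparse :=
  [seq (t.1, scall (Zneg 1) t.2) | t <- f].

(** The substitution x -> y -> z -> x. Rotating exponents destroys their order, so the terms are
    inserted one by one. *)
Definition rotatesp (f : sparse) : sparse :=
  foldr (fun t => addsp [:: (rotr 1 t.1, t.2)]) [::] f.

(* If L is invariant under the cyclic permutation of the variables, then P_1
   can be chosen to determine P_2 and P_3. *)
Definition cyclic (f : sparse) : seq sparse :=
  [:: f; rotatesp f; rotatesp (rotatesp f)].

(** The substitution of x_i^2 for every x_i, which keeps the terms sorted. *)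
Definition squaresp (f : sparse) : sparse :=
  [seq (scall (Zpos 2) t.1, t.2) | t <- f].

Declare Scope sparse_scope.
Delimit Scope sparse_scope with sparse.
Bind Scope sparse_scope with sparse.
Local Notation "f + g" := (addsp f g) : sparse_scope.
Local Notation "f * g" := (mulsp f g) : sparse_scope.
Local Notation "- f" := (oppsp f) : sparse_scope.
Local Notation "f - g" := (addsp f (oppsp g)) : sparse_scope.

Section Data.
Local Open Scope Z_scope.

Definition monomial (a : seq Z) : sparse := [:: (a, [:: 1])].

Section TwoVariables.
Local Open Scope sparse_scope.
Let c := monomial [:: 0; 0].
Let x := monomial [:: 1; 0].
Let y := monomial [:: 0; 1].
Let xy_inv := monomial [:: -1; -1].

(** The coefficient of x^n y^n in ((1 + x)(1 + y)(x + y))^n is the sum of the cubes of the binomial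
    coefficients. *)
Definition factors_A : seq sparse := [:: xy_inv; c + x; c + y; x + y].
(** The product is 3 - (1 + x^3 + y^3)/(xy), by the classical factorization of 1 + x^3 + y^3 -
    3xy. *)
Definition factors_B : seq sparse :=
  [:: - xy_inv; c + x + y; c + x * x + y * y - x - y - x * y].
(** The product is (1 + x + y)(1 + 1/x + 1/y), so the constant terms are sums of squares of
    trinomial coefficients; [factors_alpha] is the analogue in three variables. *)
Definition factors_C : seq sparse := [:: xy_inv; c + x + y; x * y + x + y].
Definition factors_D : seq sparse := [:: xy_inv; c + x; c + y; c + x + y].
(** A difference of two squares: (1 + xy)^2 - (x - y)^2, divided by xy, is 4 + (x - 1/x)(y -
    1/y). *)
Definition factors_E : seq sparse :=
  [:: xy_inv; c + x * y - x + y; c + x * y + x - y].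
(* By Heron's formula for the last four factors, this is [laurent_F] at
   (x^2, y^2); squaring the variables does not change constant terms. *)
Definition factors_F : seq sparse :=
  [:: xy_inv; xy_inv; c + x * x + y * y;
      c + x + y; x + y - c; c + x - y; c + y - x].
Definition laurent_F : sparse :=
  xy_inv * (c + x + y)
  * (x + x + y + y + x * y + x * y - c - x * x - y * y).
End TwoVariables.

Section ThreeVariables.
Local Open Scope sparse_scope.
Let c := monomial [:: 0; 0; 0].
Let x := monomial [:: 1; 0; 0].
Let y := monomial [:: 0; 1; 0].
Let z := monomial [:: 0; 0; 1].
Let xyz_inv := monomial [:: -1; -1; -1].
(** The second elementary symmetric polynomial of 1, x, y, z. *)
Let e := x + y + z + x * y + y * z + z * x.

Definition factors_delta : seq sparse :=
  [:: xyz_inv; y + z + y * z; e - c - x * x - y * y - z * z].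
(** The cyclic shift of the variables permutes the last three factors. *)
Definition factors_eta : seq sparse :=
  [:: xyz_inv; z * x + x * y - y * z - x - c;
      x * y + y * z - z * x - y - c; y * z + z * x - x * y - z - c].
Definition factors_alpha : seq sparse :=
  [:: xyz_inv; c + x + y + z; x * y * z + y * z + x * z + x * y].
Definition factors_epsilon : seq sparse :=
  [:: xyz_inv; c + x + y + z; c + x; c + y; c + z].
(** The last factor is (1 + x)(1 + y)(1 + z) - 1. *)
Definition factors_zeta : seq sparse := [:: xyz_inv; x + y + z; e + x * y * z].
Definition factors_gamma : seq sparse :=
  [:: xyz_inv; x + y; c + z; x + y + z; c + y + z].
Definition factors_s7 : seq sparse :=
  [:: xyz_inv; c + x; c + y; c + z; c + x + y + x * z].
(** Choosing (xyz)^k from (1 + xyz)^n leaves the exponent n - k for each variable, whence the sum of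
    fourth powers of binomial coefficients. *)
Definition factors_s10 : seq sparse :=
  [:: xyz_inv; c + x; c + y; c + z; c + x * y * z].
Definition factors_s18 : seq sparse :=
  [:: xyz_inv; e; e - c - x * x - y * y - z * z].
End ThreeVariables.

Definition factors (s : sporadic) : seq sparse :=
  match s with
  | seqA => factors_A
  | seqB => factors_B
  | seqC => factors_C
  | seqD => factors_D
  | seqE => factors_E
  | seqF => factors_F
  | seq_delta => factors_delta
  | seq_eta => factors_eta
  | seq_alpha => factors_alpha
  | seq_epsilon => factors_epsilon
  | seq_zeta => factors_zeta
  | seq_gamma => factors_gamma
  | seq_s7 => factors_s7
  | seq_s10 => factors_s10
  | seq_s18 => factors_s18
  end.

(** * Certificates P_i for the recurrences *)

Definition cert_A_1 : sparse := [::
  ([:: -2; 0], [:: -1; -1]); ([:: -2; 1], [:: -2; -2]);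
  ([:: -2; 2], [:: -1; -1]); ([:: -1; -1], [:: -2; -3]);
  ([:: -1; 0], [:: -4; -4]); ([:: -1; 1], [:: -3; -5]);
  ([:: 0; -2], [:: -1; -1]); ([:: 0; -1], [:: -1]); ([:: 0; 1], [:: 1]);
  ([:: 0; 2], [:: 1; 1]); ([:: 1; -1], [:: 3; 5]); ([:: 1; 0], [:: 4; 4]);
  ([:: 1; 1], [:: 2; 3]); ([:: 2; -2], [:: 1; 1]); ([:: 2; -1], [:: 2; 2]);
  ([:: 2; 0], [:: 1; 1])].

Definition cert_A_2 : sparse := [::
  ([:: -1; -1], [:: -1; -2]); ([:: -1; 0], [:: -2; -5]);
  ([:: -1; 2], [:: 1; 3]); ([:: 0; -2], [:: -1; -1]);
  ([:: 0; -1], [:: -2; -6]); ([:: 0; 1], [:: 2; 6]); ([:: 0; 2], [:: 1; 1]);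
  ([:: 1; -2], [:: -1; -3]); ([:: 1; 0], [:: 2; 5]); ([:: 1; 1], [:: 1; 2])].

Definition cert_B_1 : sparse := [::
  ([:: -2; -2], [:: -2; -2]); ([:: -2; 1], [:: -4; -4]);
  ([:: -2; 4], [:: -2; -2]); ([:: -1; -1], [:: 6]); ([:: -1; 2], [:: 6]);
  ([:: 1; -2], [:: -1; -1]); ([:: 1; 1], [:: -1; 8]); ([:: 2; -1], [:: -3]);
  ([:: 4; -2], [:: 1; 1])].

Definition cert_B_2 : sparse := [::
  ([:: 1; -2], [:: 0; -9]); ([:: 1; 1], [:: 0; 9])].

Definition cert_C_1 : sparse := [::
  ([:: -2; 0], [:: -1; -1]); ([:: -2; 1], [:: -2; -2]);
  ([:: -2; 2], [:: -1; -1]); ([:: -1; -1], [:: -2; -3]);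
  ([:: -1; 0], [:: -5; -4]); ([:: -1; 1], [:: -4; -5]);
  ([:: 0; -2], [:: -1; -1]); ([:: 0; -1], [:: -2]); ([:: 0; 1], [:: 2]);
  ([:: 0; 2], [:: 1; 1]); ([:: 1; -1], [:: 4; 5]); ([:: 1; 0], [:: 5; 4]);
  ([:: 1; 1], [:: 2; 3]); ([:: 2; -2], [:: 1; 1]); ([:: 2; -1], [:: 2; 2]);
  ([:: 2; 0], [:: 1; 1])].

Definition cert_C_2 : sparse := [::
  ([:: -1; -1], [:: -1; -2]); ([:: -1; 0], [:: -2; -5]);
  ([:: -1; 2], [:: 1; 3]); ([:: 0; -2], [:: -1; -1]);
  ([:: 0; -1], [:: -3; -6]); ([:: 0; 1], [:: 3; 6]); ([:: 0; 2], [:: 1; 1]);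
  ([:: 1; -2], [:: -1; -3]); ([:: 1; 0], [:: 2; 5]); ([:: 1; 1], [:: 1; 2])].

Definition cert_D_1 : sparse := [::
  ([:: -2; -2], [:: -1; -1]); ([:: -2; -1], [:: -4; -4]);
  ([:: -2; 0], [:: -6; -6]); ([:: -2; 1], [:: -4; -4]);
  ([:: -2; 2], [:: -1; -1]); ([:: -1; -1], [:: -3; -4]);
  ([:: -1; 0], [:: -8; -14]); ([:: -1; 1], [:: -5; -10]);
  ([:: 0; -2], [:: 4; 4]); ([:: 0; -1], [:: 6; 6]); ([:: 0; 0], [:: 1; -6]);
  ([:: 0; 1], [:: 1; -3]); ([:: 0; 2], [:: 1; 1]); ([:: 1; -2], [:: 4; 4]);
  ([:: 1; -1], [:: 7; 8]); ([:: 1; 0], [:: 4; 3]); ([:: 1; 1], [:: 2; 3]);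
  ([:: 2; -2], [:: 1; 1]); ([:: 2; -1], [:: 2; 2]); ([:: 2; 0], [:: 1; 1])].

Definition cert_D_2 : sparse := [::
  ([:: -1; -2], [:: -2; -6]); ([:: -1; -1], [:: -6; -18]);
  ([:: -1; 0], [:: -5; -15]); ([:: -1; 2], [:: 1; 3]);
  ([:: 0; -2], [:: -4; -8]); ([:: 0; -1], [:: -8; -14]);
  ([:: 0; 0], [:: -3; -2]); ([:: 0; 1], [:: 2; 5]); ([:: 0; 2], [:: 1; 1]);
  ([:: 1; -2], [:: -2; -2]); ([:: 1; -1], [:: -2; 2]); ([:: 1; 0], [:: 1; 6]);
  ([:: 1; 1], [:: 1; 2])].

Definition cert_E_1 : sparse := [::
  ([:: -2; -2], [:: -1; -1]); ([:: -2; 0], [:: 2; 2]);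
  ([:: -2; 2], [:: -1; -1]); ([:: -1; -1], [:: -4]); ([:: -1; 1], [:: 4]);
  ([:: 1; -1], [:: -4]); ([:: 1; 1], [:: 4]); ([:: 2; -2], [:: 1; 1]);
  ([:: 2; 0], [:: -2; -2]); ([:: 2; 2], [:: 1; 1])].

Definition cert_E_2 : sparse := [::
  ([:: 0; -2], [:: 0; 4]); ([:: 0; 2], [:: 0; -4])].

Definition cert_F_1 : sparse := [::
  ([:: -2; -2], [:: -2; -2]); ([:: -2; -1], [:: 4; 4]);
  ([:: -2; 0], [:: 2; 2]); ([:: -2; 1], [:: -8; -8]); ([:: -2; 2], [:: 2; 2]);
  ([:: -2; 3], [:: 4; 4]); ([:: -2; 4], [:: -2; -2]);
  ([:: -1; -2], [:: 4; 4]); ([:: -1; -1], [:: 10; -2]);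
  ([:: -1; 0], [:: -14; -2]); ([:: -1; 1], [:: -8; 4]);
  ([:: -1; 2], [:: 6; -6]); ([:: -1; 3], [:: 2; 2]); ([:: 0; -2], [:: 1; 1]);
  ([:: 0; -1], [:: -17; -7]); ([:: 0; 0], [:: -5; 5]);
  ([:: 0; 1], [:: 5; -5]); ([:: 0; 2], [:: 0; -10]);
  ([:: 1; -2], [:: -4; -4]); ([:: 1; -1], [:: -7; 3]);
  ([:: 1; 0], [:: 12; 4]); ([:: 1; 1], [:: 1; 15]); ([:: 2; -1], [:: -3; 3]);
  ([:: 2; 0], [:: 1; -5]); ([:: 3; -1], [:: -3; -1]); ([:: 4; -2], [:: 1; 1])].

Definition cert_F_2 : sparse := [::
  ([:: -1; -2], [:: 2; 2]); ([:: -1; -1], [:: -4; -4]);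
  ([:: -1; 0], [:: -2; -2]); ([:: -1; 1], [:: 6; 6]);
  ([:: -1; 3], [:: -2; -2]); ([:: 0; -2], [:: 1; 3]);
  ([:: 0; -1], [:: -14; -2]); ([:: 0; 0], [:: -4; 4]);
  ([:: 0; 1], [:: 14; 2]); ([:: 0; 2], [:: 3; -7]);
  ([:: 1; -2], [:: -5; -15]); ([:: 1; -1], [:: -23; 3]);
  ([:: 1; 0], [:: -9; -7]); ([:: 1; 1], [:: 1; 15]); ([:: 2; -2], [:: -1; 5]);
  ([:: 2; 0], [:: -3; -9]); ([:: 3; -2], [:: 3; 5]); ([:: 3; -1], [:: 1; 3])].

Definition cert_delta_1 : sparse := [::
  ([:: -2; -2; 0], [:: -4; -8; -4]); ([:: -2; -2; 1], [:: 8; 16; 8]);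
  ([:: -2; -2; 2], [:: -12; -24; -12]); ([:: -2; -2; 3], [:: 8; 16; 8]);
  ([:: -2; -2; 4], [:: -4; -8; -4]); ([:: -2; -1; -1], [:: -8; -16; -8]);
  ([:: -2; -1; 0], [:: 16; 32; 16]); ([:: -2; -1; 1], [:: -8; -16; -8]);
  ([:: -2; -1; 2], [:: -8; -16; -8]); ([:: -2; -1; 3], [:: 16; 32; 16]);
  ([:: -2; -1; 4], [:: -8; -16; -8]); ([:: -2; 0; -2], [:: -4; -8; -4]);
  ([:: -2; 0; -1], [:: 16; 32; 16]); ([:: -2; 0; 0], [:: 4; 8; 4]);
  ([:: -2; 0; 1], [:: -8; -16; -8]); ([:: -2; 0; 2], [:: 4; 8; 4]);
  ([:: -2; 0; 3], [:: 16; 32; 16]); ([:: -2; 0; 4], [:: -4; -8; -4]);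
  ([:: -2; 1; -2], [:: 8; 16; 8]); ([:: -2; 1; -1], [:: -8; -16; -8]);
  ([:: -2; 1; 0], [:: -8; -16; -8]); ([:: -2; 1; 1], [:: -8; -16; -8]);
  ([:: -2; 1; 2], [:: -8; -16; -8]); ([:: -2; 1; 3], [:: 8; 16; 8]);
  ([:: -2; 2; -2], [:: -12; -24; -12]); ([:: -2; 2; -1], [:: -8; -16; -8]);
  ([:: -2; 2; 0], [:: 4; 8; 4]); ([:: -2; 2; 1], [:: -8; -16; -8]);
  ([:: -2; 2; 2], [:: -12; -24; -12]); ([:: -2; 3; -2], [:: 8; 16; 8]);
  ([:: -2; 3; -1], [:: 16; 32; 16]); ([:: -2; 3; 0], [:: 16; 32; 16]);
  ([:: -2; 3; 1], [:: 8; 16; 8]); ([:: -2; 4; -2], [:: -4; -8; -4]);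
  ([:: -2; 4; -1], [:: -8; -16; -8]); ([:: -2; 4; 0], [:: -4; -8; -4]);
  ([:: -1; -1; -1], [:: 18; 52; 34]); ([:: -1; -1; 0], [:: -6; -32; -38]);
  ([:: -1; -1; 1], [:: 20; -27; -5]); ([:: -1; -1; 2], [:: -6; 4; -74]);
  ([:: -1; -1; 3], [:: 10; -2; -48]); ([:: -1; 0; -2], [:: 4; 8; 4]);
  ([:: -1; 0; -1], [:: -2; -36; -38]); ([:: -1; 0; 0], [:: -18; -76; -22]);
  ([:: -1; 0; 1], [:: -18; -25; -1]); ([:: -1; 0; 2], [:: -6; 4; -74]);
  ([:: -1; 0; 3], [:: 4; 0; -12]); ([:: -1; 1; -1], [:: 2; 43; -57]);
  ([:: -1; 1; 0], [:: -24; -57; -99]); ([:: -1; 1; 1], [:: -6; -8; -70]);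
  ([:: -1; 2; -1], [:: 0; -64; -12]); ([:: -1; 2; 0], [:: 4; -72; -8]);
  ([:: -1; 2; 1], [:: 4; -4]); ([:: -1; 3; -2], [:: 4; 8; 4]);
  ([:: -1; 3; -1], [:: 8; 48; 72]); ([:: -1; 3; 0], [:: 8; 20; 12]);
  ([:: 0; -2; 0], [:: 4; 8; 4]); ([:: 0; -2; 1], [:: 8; 16; 8]);
  ([:: 0; -2; 2], [:: 4; 8; 4]); ([:: 0; -1; -1], [:: -10; -36; -26]);
  ([:: 0; -1; 0], [:: 2; 12; 54]); ([:: 0; -1; 1], [:: 14; 65; 29]);
  ([:: 0; -1; 2], [:: -2; 44; 94]); ([:: 0; 0; -1], [:: -10; -8; 38]);
  ([:: 0; 0; 0], [:: 16; 56; 60]); ([:: 0; 0; 1], [:: -2; 64; 26]);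
  ([:: 0; 0; 2], [:: 0; 24; 24]); ([:: 0; 1; -2], [:: 0; -8; -8]);
  ([:: 0; 1; -1], [:: 4; -9; -15]); ([:: 0; 1; 0], [:: -4; -8; -20]);
  ([:: 0; 1; 1], [:: -8; -12; -12]); ([:: 0; 2; -2], [:: 0; 16; 16]);
  ([:: 0; 2; 0], [:: -4; 8; 12]); ([:: 1; -2; 0], [:: -8; -16; -8]);
  ([:: 1; -2; 1], [:: -8; -16; -8]); ([:: 1; -1; -1], [:: 2; 20; 18]);
  ([:: 1; -1; 0], [:: -28; -46; -10]); ([:: 1; -1; 1], [:: -6; -62; -44]);
  ([:: 1; 0; -2], [:: -4; -8; -4]); ([:: 1; 0; -1], [:: -20; -50; -14]);
  ([:: 1; 0; 0], [:: -20; -72; -24]); ([:: 1; 0; 1], [:: -4; -24; -12]);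
  ([:: 1; 1; -2], [:: -4; -16; -12]); ([:: 1; 1; -1], [:: -8; 0; -24]);
  ([:: 1; 1; 0], [:: 0; -12; -12]); ([:: 2; -2; 0], [:: 4; 8; 4]);
  ([:: 2; -1; -1], [:: 8; 16; 8]); ([:: 2; -1; 0], [:: 8; 16; 8]);
  ([:: 2; 0; -2], [:: 4; 8; 4]); ([:: 2; 0; -1], [:: 8; 16; 8]);
  ([:: 2; 0; 0], [:: 4; 8; 4])].

Definition cert_delta_2 : sparse := [::
  ([:: -1; -2; 0], [:: 4; 16; 12]); ([:: -1; -2; 3], [:: 4; 16; 12]);
  ([:: -1; -1; -1], [:: 0; 6; 2]); ([:: -1; -1; 0], [:: 0; -4; 4]);
  ([:: -1; -1; 1], [:: -12; 5; 47]); ([:: -1; 0; -2], [:: -4; -8; -4]);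
  ([:: -1; 0; -1], [:: -8; -22; 22]); ([:: -1; 0; 0], [:: -4; 13; 55]);
  ([:: -1; 0; 1], [:: -4; 2; 2]); ([:: -1; 0; 2], [:: -8; -30; 6]);
  ([:: -1; 0; 3], [:: -4; -16; -12]); ([:: -1; 1; -1], [:: 12; 18; 2]);
  ([:: -1; 1; 0], [:: 28; 31; -123]); ([:: -1; 1; 1], [:: 12; 1; -45]);
  ([:: -1; 3; -2], [:: -4; -8; -4]); ([:: -1; 3; -1], [:: -8; -16; 24]);
  ([:: -1; 3; 0], [:: -4; -4]); ([:: 0; -2; 0], [:: -4; -24; -20]);
  ([:: 0; -2; 1], [:: -8; 0; 8]); ([:: 0; -2; 2], [:: -4; -24; -20]);
  ([:: 0; -1; -1], [:: 0; -12; -60]); ([:: 0; -1; 0], [:: -12; -24; 48]);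
  ([:: 0; -1; 1], [:: -8; -23; -13]); ([:: 0; -1; 2], [:: 4; 24; 20]);
  ([:: 0; 0; -2], [:: 4; 24; 20]); ([:: 0; 0; -1], [:: 12; 11; 9]);
  ([:: 0; 0; 0], [:: 12; -24; 12]); ([:: 0; 0; 1], [:: 24; 37; -33]);
  ([:: 0; 0; 2], [:: 8; 48; 40]); ([:: 0; 1; -2], [:: 8; 0; -8]);
  ([:: 0; 1; -1], [:: 20; -1; -35]); ([:: 0; 1; 0], [:: 24; 0; -36]);
  ([:: 0; 1; 1], [:: 12; 0; -12]); ([:: 0; 2; -2], [:: 4; 24; 20]);
  ([:: 0; 2; -1], [:: 8; 48; 40]); ([:: 0; 2; 0], [:: 4; 24; 20]);
  ([:: 1; -2; 0], [:: 4; 8; 4]); ([:: 1; -2; 1], [:: 4; 8; 4]);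
  ([:: 1; -1; -1], [:: 0; 18; 46]); ([:: 1; -1; 0], [:: 12; 18; 2]);
  ([:: 1; -1; 1], [:: -8; -24; -16]); ([:: 1; 0; -2], [:: -4; -16; -12]);
  ([:: 1; 0; -1], [:: -4; -10; -10]); ([:: 1; 0; 0], [:: -12; -28; -24]);
  ([:: 1; 0; 1], [:: -12; -32; -20]); ([:: 1; 1; -2], [:: -4; -16; -12]);
  ([:: 1; 1; -1], [:: -8; -32; -56]); ([:: 1; 1; 0], [:: -4; -20; -16])].

Definition cert_delta_3 : sparse := [::
  ([:: -1; -1; -1], [:: 4; 10; 2]); ([:: -1; -1; 0], [:: -8; -20; -44]);
  ([:: -1; -1; 1], [:: 4; 10; 2]); ([:: -1; -1; 3], [:: -4; -10; -42]);
  ([:: -1; 0; -2], [:: 4; 12; 8]); ([:: -1; 0; -1], [:: -8; 0; 8]);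
  ([:: -1; 0; 0], [:: -4; 19; 57]); ([:: -1; 0; 1], [:: 12; 3; 57]);
  ([:: -1; 0; 3], [:: -4; -8; -12]); ([:: -1; 1; -2], [:: -4; 0; 4]);
  ([:: -1; 1; -1], [:: 0; 11; 45]); ([:: -1; 1; 0], [:: 4; -14; -6]);
  ([:: -1; 1; 1], [:: 8; -21; -51]); ([:: -1; 1; 2], [:: 4; -4]);
  ([:: -1; 2; -2], [:: 4; 0; -4]); ([:: -1; 2; 0], [:: -8; 8; -24]);
  ([:: -1; 2; 1], [:: -4; 4]); ([:: 0; -1; -1], [:: -4; -36; -80]);
  ([:: 0; -1; 0], [:: -4; 1; 67]); ([:: 0; -1; 1], [:: 4; 1; -61]);
  ([:: 0; -1; 2], [:: 4; 36; 80]); ([:: 0; 0; -2], [:: -4; -24; -20]);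
  ([:: 0; 0; -1], [:: -12; -24; 48]); ([:: 0; 0; 1], [:: 12; 24; -48]);
  ([:: 0; 0; 2], [:: 4; 24; 20]); ([:: 0; 1; -2], [:: -4; 0; 4]);
  ([:: 0; 1; -1], [:: -4; -1; 1]); ([:: 0; 1; 0], [:: 4; -1; -7]);
  ([:: 0; 1; 1], [:: 4; 0; -4]); ([:: 1; -1; -1], [:: 4; 38; 62]);
  ([:: 1; -1; 0], [:: 4; 8; 36]); ([:: 1; -1; 1], [:: -4; -38; -22]);
  ([:: 1; 0; -2], [:: 4; 12; 8]); ([:: 1; 0; -1], [:: 8; 14; 10]);
  ([:: 1; 0; 0], [:: 0; -18; 26]); ([:: 1; 0; 1], [:: -4; -16; -4])].

Definition cert_eta : sparse := [::
  ([:: -2; -2; -2], [:: -19320; -38640; -19320]);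
  ([:: -2; -2; -1], [:: -96600; -231840; -135240]);
  ([:: -2; -2; 0], [:: -19320; -38640; -19320]);
  ([:: -2; -1; -1], [:: -57960; -463680; 486192]);
  ([:: -2; -1; 0], [:: -318780; 1173664; 821087]);
  ([:: -2; -1; 1], [:: -318780; 859714; 1178494]);
  ([:: -2; 0; -2], [:: -38640; -77280; -38640]);
  ([:: -2; 0; -1], [:: -318780; 69200; -763127]);
  ([:: -2; 0; 0], [:: -347760; 969192; -621432]);
  ([:: -2; 0; 1], [:: 313950; -57947; -1120534]);
  ([:: -2; 0; 2], [:: 115920; 270480; 154560]);
  ([:: -2; 1; -1], [:: -318780; -273730; 45050]);
  ([:: -2; 1; 0], [:: 188370; 247955; 924142]);
  ([:: -2; 1; 1], [:: 444360; -1027152; 1320144]);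
  ([:: -2; 1; 2], [:: -115920; -231840; -115920]);
  ([:: -2; 2; 0], [:: 115920; 231840; 115920]);
  ([:: -2; 2; 1], [:: -115920; -231840; -115920]);
  ([:: -2; 2; 4], [:: -57960; -115920; -57960]);
  ([:: -2; 3; 3], [:: -115920; -231840; -115920]);
  ([:: -2; 3; 4], [:: 115920; 231840; 115920]);
  ([:: -2; 4; 2], [:: -57960; -115920; -57960]);
  ([:: -2; 4; 3], [:: 115920; 231840; 115920]);
  ([:: -2; 4; 4], [:: -57960; -115920; -57960]);
  ([:: -1; -2; -1], [:: 115920; 270480; 154560]);
  ([:: -1; -2; 0], [:: 294630; 1012707; 718077]);
  ([:: -1; -2; 1], [:: 318780; 273730; -45050]);
  ([:: -1; -1; -2], [:: 154560; -698712; -853272]);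
  ([:: -1; -1; -1], [:: 386400; -853272; 447552]);
  ([:: -1; -1; 0], [:: 188370; 3491844; 1371612]);
  ([:: -1; -1; 1], [:: -236670; 1678117; 1293630]);
  ([:: -1; -1; 2], [:: -57960; -685860; -9660]);
  ([:: -1; 0; -2], [:: 323610; -1675971; -1999581]);
  ([:: -1; 0; -1], [:: 4830; -2641764; -2472852]);
  ([:: -1; 0; 0], [:: 282348; 347952; -1557660]);
  ([:: -1; 0; 1], [:: -371019; -1507790; -830290]);
  ([:: -1; 0; 2], [:: -12282; -913080; 2061546]);
  ([:: -1; 0; 3], [:: -729744; 77468; 1921336]);
  ([:: -1; 1; -2], [:: 318780; -859714; -1178494]);
  ([:: -1; 1; -1], [:: 62790; -2315677; -1593090]);
  ([:: -1; 1; 0], [:: 3780999; 59114; -584954]);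
  ([:: -1; 1; 1], [:: -144900; -438324; -1593624]);
  ([:: -1; 1; 2], [:: -1973262; -3246442; 3628844]);
  ([:: -1; 1; 3], [:: 2401940; 2048472; -4321808]);
  ([:: -1; 1; 4], [:: 347760; 1449000; 1101240]);
  ([:: -1; 2; -1], [:: -57960; -299460; -260820]);
  ([:: -1; 2; 0], [:: 654258; 1221780; -1525422]);
  ([:: -1; 2; 1], [:: -997602; 1321486; -1092056]);
  ([:: -1; 2; 2], [:: 627900; 217488; -1962780]);
  ([:: -1; 2; 3], [:: -1286988; -3520104; -1544496]);
  ([:: -1; 3; 0], [:: -729744; -2189420; -2612440]);
  ([:: -1; 3; 1], [:: -826532; -782460; 3452132]);
  ([:: -1; 3; 2], [:: -369288; 1022028; 2129340]);
  ([:: -1; 3; 3], [:: 1615428; 4751616; 2867640]);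
  ([:: -1; 3; 4], [:: -57960; -231840; -173880]);
  ([:: -1; 4; 3], [:: -579600; -1796760; -1217160]);
  ([:: 0; -2; -2], [:: 19320; 38640; 19320]);
  ([:: 0; -2; -1], [:: -202860; 1168834; 1371694]);
  ([:: 0; -2; 0], [:: -24150; -307495; -283345]);
  ([:: 0; -2; 1], [:: 9660; -547402; -557062]);
  ([:: 0; -1; -2], [:: -144900; -895162; -750262]);
  ([:: 0; -1; -1], [:: -734160; 1397424; 54768]);
  ([:: 0; -1; 0], [:: -265650; -851288; 1809226]);
  ([:: 0; -1; 1], [:: -149730; -1907271; -311458]);
  ([:: 0; -1; 2], [:: -57960; -1204878; -2005794]);
  ([:: 0; -1; 3], [:: 0; -768572; -1921336]);
  ([:: 0; 0; -2], [:: 4830; 230215; 225385]);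
  ([:: 0; 0; -1], [:: -661710; 3229772; -225862]);
  ([:: 0; 0; 0], [:: -181332; 2015856; -1834524]);
  ([:: 0; 0; 1], [:: 1212029; 1272456; 4100672]);
  ([:: 0; 0; 2], [:: -608994; 5211772; -2468338]);
  ([:: 0; 0; 3], [:: -1498316; -1917008; 2791012]);
  ([:: 0; 0; 4], [:: -347760; -2086560; -1738800]);
  ([:: 0; 1; -2], [:: -338100; 821074; 1159174]);
  ([:: 0; 1; -1], [:: -545790; 1761303; -619934]);
  ([:: 0; 1; 0], [:: 841135; -5911608; 584884]);
  ([:: 0; 1; 1], [:: -2208276; 1618248; -3777960]);
  ([:: 0; 1; 2], [:: 1853716; 4989586; 1342130]);
  ([:: 0; 1; 3], [:: 443938; 4015102; 5978452]);
  ([:: 0; 1; 4], [:: -985320; -2724120; -1738800]);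
  ([:: 0; 2; -1], [:: -57960; -731538; 2392614]);
  ([:: 0; 2; 0], [:: -889134; -763480; 1365166]);
  ([:: 0; 2; 1], [:: -3714508; 105518; 2032462]);
  ([:: 0; 2; 2], [:: 668748; -350244; 3256536]);
  ([:: 0; 2; 3], [:: -3122388; -9939404; -8095264]);
  ([:: 0; 2; 4], [:: 695520; 1391040; 695520]);
  ([:: 0; 3; -1], [:: 0; 1498316; 2612440]);
  ([:: 0; 3; 0], [:: 1556276; 2521724; -549892]);
  ([:: 0; 3; 1], [:: 4733822; 2652230; -7645492]);
  ([:: 0; 3; 2], [:: -1509168; -2532484; -2519144]);
  ([:: 0; 3; 3], [:: 763140; 2219868; 1271256]);
  ([:: 0; 4; 0], [:: 0; -115920; -115920]);
  ([:: 0; 4; 1], [:: 289800; 1333080; 1043280]);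
  ([:: 0; 4; 2], [:: 637560; 1275120; 637560]);
  ([:: 1; -2; -1], [:: -318780; 859714; 1178494]);
  ([:: 1; -2; 0], [:: 458850; -1328211; -1787061]);
  ([:: 1; -2; 1], [:: -328440; 273672; 602112]);
  ([:: 1; -1; -2], [:: -318780; -273730; 45050]);
  ([:: 1; -1; -1], [:: 19320; 154560; 569940]);
  ([:: 1; -1; 0], [:: 1434510; -4344912; 1128663]);
  ([:: 1; -1; 1], [:: -62790; -1902885; -4029990]);
  ([:: 1; -1; 2], [:: -115920; 10074; -720286]);
  ([:: 1; -1; 3], [:: -57960; 370304; 1530796]);
  ([:: 1; -1; 4], [:: 57960; 753480; 695520]);
  ([:: 1; 0; -2], [:: 236670; 896787; 660117]);
  ([:: 1; 0; -1], [:: 1077090; 1868928; 1236501]);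
  ([:: 1; 0; 1], [:: 1286097; -230237; -3983078]);
  ([:: 1; 0; 2], [:: -5281222; -3802984; 1824634]);
  ([:: 1; 0; 3], [:: 3032282; 1999490; -4318036]);
  ([:: 1; 0; 4], [:: 869400; 2492280; 1622880]);
  ([:: 1; 1; -1], [:: -14490; 1709685; 1196262]);
  ([:: 1; 1; 0], [:: -3126741; 782309; 5329610]);
  ([:: 1; 1; 1], [:: 1106484; -706632; -361212]);
  ([:: 1; 1; 2], [:: 2882502; -1204344; -9448542]);
  ([:: 1; 1; 3], [:: -250562; 1818978; 4654280]);
  ([:: 1; 1; 4], [:: -463680; -173880; 289800]);
  ([:: 1; 2; -1], [:: 115920; 1417398; 167110]);
  ([:: 1; 2; 0], [:: 2054782; 2182324; 24986]);
  ([:: 1; 2; 1], [:: 2178510; -2162448; 687858]);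
  ([:: 1; 2; 2], [:: 2390436; 6403200; 6192060]);
  ([:: 1; 2; 3], [:: 45080; 305256; 291088]);
  ([:: 1; 3; -1], [:: 115920; -1237496; -2902240]);
  ([:: 1; 3; 0], [:: -2175302; -1179770; 5632072]);
  ([:: 1; 3; 1], [:: -2797582; -3401010; 1830616]);
  ([:: 1; 3; 2], [:: -1194620; -2608200; -463036]);
  ([:: 1; 4; -1], [:: 57960; 231840; 173880]);
  ([:: 1; 4; 0], [:: -405720; -1564920; -1159200]);
  ([:: 1; 4; 1], [:: 57960; 869400; 811440]);
  ([:: 2; -2; 0], [:: 19320; 38640; 19320]);
  ([:: 2; -1; -1], [:: 96600; 270480; -125580]);
  ([:: 2; -1; 0], [:: -96600; 1289076; -1088064]);
  ([:: 2; -1; 1], [:: -96600; -2248572; 670548]);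
  ([:: 2; -1; 2], [:: 57960; 521640; -1109316]);
  ([:: 2; 0; -1], [:: 38640; -40728; -286284]);
  ([:: 2; 0; 0], [:: -144900; -1871004; 2073864]);
  ([:: 2; 0; 1], [:: 1274526; -2976594; -457958]);
  ([:: 2; 0; 2], [:: -419202; -4525008; 4861686]);
  ([:: 2; 0; 3], [:: -339526; 185702; -1237216]);
  ([:: 2; 0; 4], [:: -57960; -115920; -57960]);
  ([:: 2; 1; 0], [:: -772206; 6362286; -1989274]);
  ([:: 2; 1; 1], [:: -1160028; 1450800; 3242460]);
  ([:: 2; 1; 2], [:: 374946; -583970; -1808260]);
  ([:: 2; 1; 3], [:: -103040; -1756188; -517132]);
  ([:: 2; 2; 0], [:: 970650; 1542960; -1271886]);
  ([:: 2; 2; 1], [:: -2040054; -2015950; -1419560]);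
  ([:: 2; 2; 2], [:: 338100; 1858584; -1423884]);
  ([:: 2; 3; 0], [:: 768154; 135838; -2295032]);
  ([:: 2; 3; 1], [:: 721280; 241500; -634340]);
  ([:: 3; -1; 0], [:: 0; 768572; -345552]);
  ([:: 3; -1; 1], [:: 0; 787704; 596436]);
  ([:: 3; -1; 2], [:: -173880; -1750668; -1120008]);
  ([:: 3; -1; 3], [:: 173880; 2137068; 1694640]);
  ([:: 3; -1; 4], [:: -57960; -753480; -695520]);
  ([:: 3; 0; -1], [:: 0; -1498316; -345552]);
  ([:: 3; 0; 0], [:: -57960; 152628; -94668]);
  ([:: 3; 0; 1], [:: 384790; 2552778; -3078328]);
  ([:: 3; 0; 3], [:: 106260; 649152; 171948]);
  ([:: 3; 1; 0], [:: -152950; -2472186; 3005464]);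
  ([:: 3; 1; 2], [:: -215740; -540960; -294308]);
  ([:: 3; 2; 1], [:: 109480; 718704; 1559768]);
  ([:: 3; 4; -1], [:: -57960; -231840; -173880]);
  ([:: 4; -1; 1], [:: -57960; -86940; 289800]);
  ([:: 4; -1; 2], [:: 57960; 289800; 347760]);
  ([:: 4; 0; 0], [:: 115920; 347760; 231840]);
  ([:: 4; 0; 1], [:: 86940; 28980; 202860]);
  ([:: 4; 0; 2], [:: -289800; -57960; 231840]);
  ([:: 4; 1; -1], [:: -57960; -260820; -521640]);
  ([:: 4; 1; 0], [:: -202860; -347760; -1159200]);
  ([:: 4; 1; 1], [:: 289800; 57960; -231840]);
  ([:: 4; 2; -1], [:: 57960; 28980; 608580])].

Definition cert_alpha : sparse := [::
  ([:: -2; 0; 0], [:: -1; -2; -1]); ([:: -2; 0; 1], [:: -2; -4; -2]);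
  ([:: -2; 0; 2], [:: -1; -2; -1]); ([:: -2; 1; 0], [:: -2; -4; -2]);
  ([:: -2; 1; 1], [:: -2; -4; -2]); ([:: -2; 2; 0], [:: -1; -2; -1]);
  ([:: -1; -1; 0], [:: -1; -4; -3]); ([:: -1; -1; 1], [:: -2; -8; -8]);
  ([:: -1; -1; 2], [:: -1; -4; -3]); ([:: -1; 0; -1], [:: -1; -4; -3]);
  ([:: -1; 0; 0], [:: -6; -14; -4]); ([:: -1; 0; 1], [:: -6; -6; 4]);
  ([:: -1; 0; 2], [:: -2; -2]); ([:: -1; 1; -1], [:: -2; -8; -8]);
  ([:: -1; 1; 0], [:: -6; -14; -4]); ([:: -1; 1; 1], [:: -2]);
  ([:: -1; 2; -1], [:: -1; -4; -3]); ([:: 0; -1; -1], [:: 0; -2; -2]);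
  ([:: 0; -1; 0], [:: 0; -2; 2]); ([:: 0; -1; 1], [:: -2; -6; 2]);
  ([:: 0; 0; -1], [:: -2; -10; -6]); ([:: 0; 0; 0], [:: -2; 2]);
  ([:: 0; 0; 1], [:: -1; 12; 5]); ([:: 0; 0; 2], [:: -1; 0; 1]);
  ([:: 0; 1; 0], [:: 1; 6; -3]); ([:: 0; 1; 1], [:: 0; 4; 2]);
  ([:: 0; 2; 0], [:: 1; 2; 1]); ([:: 1; -1; -1], [:: 0; -2; -2]);
  ([:: 1; -1; 0], [:: 2; 6; 8]); ([:: 1; -1; 1], [:: 1; 4; 9]);
  ([:: 1; 0; 0], [:: 4; 16; 4]); ([:: 1; 0; 1], [:: 0; 4; 2]);
  ([:: 1; 1; -1], [:: 1; 6; 9]); ([:: 1; 1; 0], [:: 2; 6; 2]);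
  ([:: 2; -1; 0], [:: 1; 2; 3]); ([:: 2; 0; -1], [:: 1; 4; 3]);
  ([:: 2; 0; 0], [:: 1; 2; 1])].

Definition cert_epsilon : sparse := [::
  ([:: -2; -2; -2], [:: -1; -2; -1]); ([:: -2; -2; -1], [:: -10; -22; -12]);
  ([:: -2; -2; 0], [:: -18; -38; -20]); ([:: -2; -2; 1], [:: -12; -24; -12]);
  ([:: -2; -2; 2], [:: -3; -6; -3]); ([:: -2; -1; -1], [:: -24; -62; -41]);
  ([:: -2; -1; 0], [:: -47; -106; -64]); ([:: -2; -1; 1], [:: -30; -60; -30]);
  ([:: -2; -1; 2], [:: -6; -12; -6]); ([:: -2; 0; -2], [:: 1; 2; 1]);
  ([:: -2; 0; -1], [:: -27; -91; -65]); ([:: -2; 0; 0], [:: -48; -113; -67]);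
  ([:: -2; 0; 1], [:: -24; -36; -12]); ([:: -2; 0; 2], [:: -3; -6; -3]);
  ([:: -2; 1; -1], [:: -15; -60; -45]); ([:: -2; 1; 0], [:: -21; -48; -27]);
  ([:: -2; 1; 1], [:: -6; -9; -3]); ([:: -2; 2; -1], [:: -3; -12; -9]);
  ([:: -2; 2; 0], [:: -3; -6; -3]); ([:: -1; -2; -2], [:: -2; -4; -2]);
  ([:: -1; -2; -1], [:: -18; -41; -23]); ([:: -1; -2; 0], [:: -15; -33; -18]);
  ([:: -1; -1; -1], [:: -46; -130; -92]);
  ([:: -1; -1; 0], [:: -71; -233; -181]);
  ([:: -1; -1; 1], [:: -36; -126; -102]); ([:: -1; 0; -2], [:: 1; 1]);
  ([:: -1; 0; -1], [:: -30; -104; -77]);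
  ([:: -1; 0; 0], [:: -57; -185; -154]); ([:: -1; 0; 1], [:: -12; -6; 3]);
  ([:: -1; 1; 0], [:: -24; -81; -75]); ([:: -1; 1; 1], [:: 0; 3; 3]);
  ([:: 0; -2; -2], [:: -1; -2; -1]); ([:: 0; -2; -1], [:: -8; -19; -11]);
  ([:: 0; -2; 0], [:: 15; 29; 14]); ([:: 0; -2; 1], [:: 15; 30; 15]);
  ([:: 0; -2; 2], [:: 3; 6; 3]); ([:: 0; -1; -1], [:: -25; -68; -36]);
  ([:: 0; -1; 0], [:: -3; -64; -60]); ([:: 0; -1; 1], [:: 3; -42; -54]);
  ([:: 0; -1; 2], [:: 6; 12; 6]); ([:: 0; 0; -2], [:: 0; -1; -1]);
  ([:: 0; 0; -1], [:: -6; -25; -21]); ([:: 0; 0; 0], [:: 0; -54; -90]);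
  ([:: 0; 0; 1], [:: 18; 42; 21]); ([:: 0; 0; 2], [:: 3; 6; 3]);
  ([:: 0; 1; -1], [:: 21; 84; 66]); ([:: 0; 1; 0], [:: 3; -21; -42]);
  ([:: 0; 1; 1], [:: 6; 12; 6]); ([:: 0; 2; -1], [:: 3; 12; 9]);
  ([:: 0; 2; 0], [:: 3; 6; 3]); ([:: 1; -2; 0], [:: 12; 24; 12]);
  ([:: 1; -2; 1], [:: 3; 6; 3]); ([:: 1; -1; -1], [:: 0; 18; 42]);
  ([:: 1; -1; 0], [:: 24; 75; 66]); ([:: 1; -1; 1], [:: 9; 24; 18]);
  ([:: 1; 0; 0], [:: 12; 24]); ([:: 1; 0; 1], [:: 6; 12; 6]);
  ([:: 1; 1; -1], [:: 6; 24; 21]); ([:: 1; 1; 0], [:: 6; 12; 6]);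
  ([:: 2; -1; -1], [:: 3; 18; 27]); ([:: 2; -1; 0], [:: 3; 12; 9]);
  ([:: 2; 0; -1], [:: 3; 12; 9]); ([:: 2; 0; 0], [:: 3; 6; 3])].

Definition cert_zeta : sparse := [::
  ([:: -2; -2; 2], [:: -1; -2; -1]); ([:: -2; -1; 1], [:: -4; -8; -4]);
  ([:: -2; -1; 2], [:: -2; -4; -2]); ([:: -2; 0; 0], [:: -5; -12; -7]);
  ([:: -2; 0; 1], [:: -6; -11; -5]); ([:: -2; 0; 2], [:: -1; -2; -1]);
  ([:: -2; 1; -1], [:: -2; -6; -4]); ([:: -2; 1; 0], [:: -5; -12; -7]);
  ([:: -2; 1; 1], [:: -2; -3; -1]); ([:: -2; 2; -1], [:: -1; -4; -3]);
  ([:: -2; 2; 0], [:: -1; -2; -1]); ([:: -1; -2; 1], [:: -2; -4; -2]);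
  ([:: -1; -1; 0], [:: -6; -22; -22]); ([:: -1; -1; 1], [:: -11; -29; -15]);
  ([:: -1; 0; -1], [:: -4; -20; -22]); ([:: -1; 0; 0], [:: -12; -33; -21]);
  ([:: -1; 0; 1], [:: -2; 5; 5]); ([:: -1; 0; 2], [:: 0; 4; 4]);
  ([:: -1; 1; 0], [:: -6; -17; -26]); ([:: -1; 1; 1], [:: 0; 5; 1]);
  ([:: 0; -2; 0], [:: -1; -2; -1]); ([:: 0; -2; 1], [:: 1; 2; 1]);
  ([:: 0; -2; 2], [:: 1; 2; 1]); ([:: 0; -1; -1], [:: -2; -14; -18]);
  ([:: 0; -1; 0], [:: -9; -31; -22]); ([:: 0; -1; 1], [:: -2; -9; -3]);
  ([:: 0; -1; 2], [:: 2; 4; 2]); ([:: 0; 0; -1], [:: 0; -3; -6]);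
  ([:: 0; 0; 0], [:: 0; 0; -29]); ([:: 0; 0; 1], [:: 6; 24; 12]);
  ([:: 0; 0; 2], [:: 1; 6; 5]); ([:: 0; 1; -1], [:: 6; 20; 15]);
  ([:: 0; 1; 0], [:: 1; -1; -21]); ([:: 0; 1; 1], [:: 2; 8; 2]);
  ([:: 0; 2; -1], [:: 1; 4; 3]); ([:: 0; 2; 0], [:: 1; 2; 1]);
  ([:: 1; -2; 0], [:: 1; 2; 1]); ([:: 1; -2; 1], [:: 1; 2; 1]);
  ([:: 1; -1; -1], [:: -1; -3; -2]); ([:: 1; -1; 0], [:: 5; 22; 30]);
  ([:: 1; -1; 1], [:: 3; 8; 10]); ([:: 1; 0; 0], [:: 4; 14; -1]);
  ([:: 1; 0; 1], [:: 2; 8; 2]); ([:: 1; 1; -1], [:: 2; 8; 7]);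
  ([:: 1; 1; 0], [:: 2; 4; -2]); ([:: 2; -1; -1], [:: 1; 6; 9]);
  ([:: 2; -1; 0], [:: 1; 4; 7]); ([:: 2; 0; -1], [:: 1; 4; 3]);
  ([:: 2; 0; 0], [:: 1; 2; 1])].

Definition cert_gamma_1 : sparse := [::
  ([:: -2; 0; 0], [:: -36; -72; -36]); ([:: -2; 0; 1], [:: -144; -288; -144]);
  ([:: -2; 0; 2], [:: -216; -432; -216]);
  ([:: -2; 0; 3], [:: -144; -288; -144]); ([:: -2; 0; 4], [:: -36; -72; -36]);
  ([:: -2; 1; -1], [:: -72; -144; -72]);
  ([:: -2; 1; 0], [:: -360; -702; -320]);
  ([:: -2; 1; 1], [:: -648; -1296; -648]);
  ([:: -2; 1; 2], [:: -504; -1044; -584]);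
  ([:: -2; 1; 3], [:: -144; -216; 16]); ([:: -2; 2; -2], [:: -36; -72; -36]);
  ([:: -2; 2; -1], [:: -288; -576; -288]);
  ([:: -2; 2; 0], [:: -684; -1332; -604]);
  ([:: -2; 2; 1], [:: -648; -1368; -808]);
  ([:: -2; 2; 2], [:: -216; -360; -56]);
  ([:: -2; 3; -2], [:: -72; -144; -72]);
  ([:: -2; 3; -1], [:: -288; -576; -288]);
  ([:: -2; 3; 0], [:: -360; -720; -360]);
  ([:: -2; 3; 1], [:: -144; -288; -144]);
  ([:: -2; 4; -2], [:: -36; -72; -36]); ([:: -2; 4; -1], [:: -72; -144; -72]);
  ([:: -2; 4; 0], [:: -36; -72; -36]); ([:: -1; -1; 0], [:: -72; -180; -108]);
  ([:: -1; -1; 1], [:: -432; -882; -472]);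
  ([:: -1; -1; 2], [:: -404; -990; -608]);
  ([:: -1; -1; 3], [:: -144; -576; -432]);
  ([:: -1; -1; 4], [:: -100; -288; -188]);
  ([:: -1; 0; -1], [:: 5442; -10431; -396]);
  ([:: -1; 0; 0], [:: 10344; -32970; 18774]);
  ([:: -1; 0; 1], [:: 2962; -21110; 14716]);
  ([:: -1; 0; 2], [:: -1576; -3228; -1352]);
  ([:: -1; 0; 3], [:: -552; -1448; -772]);
  ([:: -1; 1; -1], [:: 4830; -23655; 18270]);
  ([:: -1; 1; 0], [:: 4418; -19053; 9484]);
  ([:: -1; 2; -1], [:: -936; -2448; -1044]);
  ([:: -1; 2; 0], [:: -736; -4862; -558]);
  ([:: -1; 2; 1], [:: 263; 106; -848]); ([:: -1; 3; -2], [:: -72; -144; -72]);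
  ([:: -1; 3; -1], [:: -144; -432; -432]);
  ([:: -1; 3; 0], [:: -189; -1018; -1352]);
  ([:: 0; -2; 0], [:: -36; -72; -36]); ([:: 0; -2; 1], [:: -288; -576; -288]);
  ([:: 0; -2; 2], [:: -188; -332; -144]);
  ([:: 0; -2; 4], [:: -64; -172; -108]);
  ([:: 0; -1; -1], [:: -144; 5442; -10467]);
  ([:: 0; -1; 0], [:: -72; 16904; -28944]);
  ([:: 0; -1; 1], [:: -1140; 15826; -15858]);
  ([:: 0; -1; 2], [:: -624; 1171; 4324]);
  ([:: 0; -1; 3], [:: -328; -900; -448]);
  ([:: 0; 0; -2], [:: -432; -216; 216]);
  ([:: 0; 0; -1], [:: -1008; -13152; 11496]);
  ([:: 0; 0; 0], [:: -1284; -3178; 4462]);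
  ([:: 0; 0; 1], [:: 652; -6047; 3688]);
  ([:: 0; 0; 2], [:: 232; -4152; -10306]);
  ([:: 0; 1; -2], [:: -288; 432; 720]); ([:: 0; 1; -1], [:: -576; -576; 432]);
  ([:: 0; 1; 0], [:: -1824; -15638; 15844]);
  ([:: 0; 1; 1], [:: -769; -8926; -9916]); ([:: 0; 2; -2], [:: 0; 144; 144]);
  ([:: 0; 2; 0], [:: -234; -1398; -1076]);
  ([:: 1; -2; 0], [:: -144; -288; -144]); ([:: 1; -2; 2], [:: 144; 288; 144]);
  ([:: 1; -1; -1], [:: 936; 684; -4377]);
  ([:: 1; -1; 1], [:: -76; -3121; 6530]); ([:: 1; 0; -2], [:: 144; 648; 504]);
  ([:: 1; 0; -1], [:: 1116; 7926; -5766]);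
  ([:: 1; 0; 0], [:: -864; -3474; 8190]);
  ([:: 1; 0; 1], [:: -1076; -5429; 1252]); ([:: 1; 1; -2], [:: 72; 288; 216]);
  ([:: 1; 1; -1], [:: 144; 432; 432]); ([:: 1; 1; 0], [:: -45; -380; 276]);
  ([:: 2; -2; -2], [:: 36; 72; 36]); ([:: 2; -2; -1], [:: 144; 288; 144]);
  ([:: 2; -2; 0], [:: 188; 332; 144]); ([:: 2; -2; 1], [:: 144; 288; 144]);
  ([:: 2; -2; 2], [:: 64; 172; 108]); ([:: 2; -1; -2], [:: 72; 144; 72]);
  ([:: 2; -1; -1], [:: 216; 432; 216]); ([:: 2; -1; 0], [:: 188; 374; 186]);
  ([:: 2; -1; 1], [:: 100; 230; 42]); ([:: 2; 0; -2], [:: 36; 72; 36]);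
  ([:: 2; 0; -1], [:: 72; 144; 72]); ([:: 2; 0; 0], [:: 36; 72; 36])].

Definition cert_gamma_2 : sparse := [::
  ([:: -2; 0; 1], [:: 18; 58; 40]); ([:: -2; 0; 2], [:: -18; -58; -40]);
  ([:: -2; 0; 4], [:: 36; 116; 80]); ([:: -2; 1; 0], [:: 18; 58; 40]);
  ([:: -2; 1; 2], [:: -36; -116; -80]); ([:: -2; 1; 3], [:: 72; 232; 160]);
  ([:: -2; 2; 0], [:: 18; 58; 40]); ([:: -2; 2; 1], [:: -36; -116; -80]);
  ([:: -2; 2; 2], [:: 36; 116; 80]); ([:: -1; -1; 0], [:: -36; -108; -72]);
  ([:: -1; -1; 1], [:: -126; -248; -144]);
  ([:: -1; -1; 2], [:: -234; -716; -504]);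
  ([:: -1; -1; 3], [:: -144; -576; -432]);
  ([:: -1; 0; -1], [:: -108; -5802; 9783]);
  ([:: -1; 0; 0], [:: -936; -18282; 26564]);
  ([:: -1; 0; 1], [:: -1710; -16067; 8620]);
  ([:: -1; 0; 2], [:: -972; -4703; -6440]);
  ([:: -1; 1; -2], [:: -72; -144; -72]);
  ([:: -1; 1; -1], [:: -396; -6162; 9855]);
  ([:: -1; 1; 0], [:: -1080; -6849; 7998]);
  ([:: -1; 1; 1], [:: -1008; -2291; -136]);
  ([:: -1; 1; 2], [:: 36; 1300; -46]); ([:: -1; 2; 1], [:: 108; 1327; -614]);
  ([:: -1; 3; -2], [:: 72; 144; 72]); ([:: -1; 3; -1], [:: 144; 288]);
  ([:: -1; 3; 0], [:: 72; 27; -568]); ([:: 0; -2; 0], [:: -36; -72; -36]);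
  ([:: 0; -2; 1], [:: -144; -288; -144]);
  ([:: 0; -2; 2], [:: -216; -432; -216]);
  ([:: 0; -2; 3], [:: -144; -288; -144]); ([:: 0; -2; 4], [:: -36; -72; -36]);
  ([:: 0; -1; -1], [:: -5802; 9783; -468]);
  ([:: 0; -1; 0], [:: -11730; 30400; -21946]);
  ([:: 0; -1; 1], [:: -6704; 18665; -23178]);
  ([:: 0; -1; 2], [:: -776; -1952; -1700]);
  ([:: 0; 0; -2], [:: -504; -360; 144]);
  ([:: 0; 0; -1], [:: -6378; 10647; 396]);
  ([:: 0; 0; 0], [:: -6954; 4419; 3939]);
  ([:: 0; 0; 1], [:: -1426; -16336; 3026]);
  ([:: 0; 0; 2], [:: 52; -3256; -10452]); ([:: 0; 1; -2], [:: -360; 72; 432]);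
  ([:: 0; 1; -1], [:: 360; 2088; 1224]);
  ([:: 0; 1; 0], [:: 140; -3666; 8926]);
  ([:: 0; 1; 1], [:: 174; -736; -4298]); ([:: 0; 2; -2], [:: 144; 432; 288]);
  ([:: 0; 2; -1], [:: 288; 864; 576]); ([:: 0; 2; 0], [:: 158; 388; 318]);
  ([:: 1; -2; -1], [:: -36; -144; -108]);
  ([:: 1; -2; 0], [:: -144; -720; -576]);
  ([:: 1; -2; 1], [:: -244; -908; -576]);
  ([:: 1; -2; 2], [:: -144; -432; -288]);
  ([:: 1; -2; 3], [:: -8; -100; -180]);
  ([:: 1; -1; -1], [:: 936; 7278; -6918]);
  ([:: 1; -1; 0], [:: 314; -3649; 1391]);
  ([:: 1; -1; 1], [:: -678; -10155; 6588]);
  ([:: 1; 0; -2], [:: 72; 288; 216]); ([:: 1; 0; -1], [:: 1188; 8286; -5946]);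
  ([:: 1; 0; 0], [:: 522; 3866; 786]); ([:: 1; 0; 1], [:: 108; 1682; 6780]);
  ([:: 1; 1; -2], [:: 72; 288; 216]); ([:: 1; 1; -1], [:: 144; 576; 576]);
  ([:: 1; 1; 0], [:: 100; 345; 856]); ([:: 2; -2; 0], [:: -28; -100; -72]);
  ([:: 2; -2; 2], [:: 28; 100; 72]); ([:: 2; -1; 0], [:: -14; -116; -102]);
  ([:: 2; -1; 1], [:: 42; 84; 42]); ([:: 2; 0; 0], [:: 14; -16; -30])].

Definition cert_gamma_3 : sparse := [::
  ([:: -1; 0; -1], [:: -72; -5910; 9639]);
  ([:: -1; 0; 0], [:: -360; -11336; 17357]);
  ([:: -1; 0; 1], [:: -396; -5470; 7834]);
  ([:: -1; 0; 3], [:: 108; 44; -116]); ([:: -1; 1; -2], [:: -72; -360; -288]);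
  ([:: -1; 1; 0], [:: 36; 3096; 6780]); ([:: -1; 1; 1], [:: 180; 4177; 6782]);
  ([:: -1; 1; 2], [:: 216; 1441; 290]);
  ([:: -1; 2; -2], [:: -72; -576; -504]);
  ([:: -1; 2; 0], [:: 180; 1973; 910]); ([:: -1; 2; 1], [:: 108; 1397; 406]);
  ([:: 0; -1; -1], [:: -72; 5406; -10575]);
  ([:: 0; -1; 0], [:: -360; 10220; -21878]);
  ([:: 0; -1; 1], [:: -396; 4518; -11667]);
  ([:: 0; -1; 3], [:: 108; 296; 364]); ([:: 0; 0; -2], [:: -360; -432; -72]);
  ([:: 0; 0; -1], [:: -1116; -7170; 6342]);
  ([:: 0; 0; 0], [:: 1090; -8192; 8506]);
  ([:: 0; 0; 1], [:: 4088; 3398; -2266]);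
  ([:: 0; 0; 2], [:: 2242; 4852; -4358]);
  ([:: 0; 1; -2], [:: -360; -864; -432]);
  ([:: 0; 1; 0], [:: 2494; 7624; 1582]);
  ([:: 0; 1; 1], [:: 2134; 6760; 1150]);
  ([:: 1; -1; -2], [:: -72; -288; -216]);
  ([:: 1; -1; -1], [:: -288; -7458; 2145]);
  ([:: 1; -1; 0], [:: -252; -13018; 3367]);
  ([:: 1; -1; 1], [:: 72; -5386; 1588]); ([:: 1; -1; 2], [:: 108; 462; 582]);
  ([:: 1; 0; -2], [:: -72; -288; -144]);
  ([:: 1; 0; -1], [:: 612; 6270; -6882]);
  ([:: 1; 0; 0], [:: 792; 8257; -412]); ([:: 1; 0; 1], [:: 108; 1699; 6326])].

Definition cert_s7_1 : sparse := [::
  ([:: -2; -2; -2], [:: -1; -2; -1]); ([:: -2; -2; -1], [:: -2; -4; -2]);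
  ([:: -2; -2; 0], [:: -1; -2; -1]); ([:: -2; -1; -2], [:: -4; -8; -4]);
  ([:: -2; -1; -1], [:: -8; -16; -8]); ([:: -2; -1; 0], [:: -4; -8; -4]);
  ([:: -2; 0; -2], [:: -6; -12; -6]); ([:: -2; 0; -1], [:: -12; -24; -12]);
  ([:: -2; 0; 0], [:: -6; -12; -6]); ([:: -2; 1; -2], [:: -4; -8; -4]);
  ([:: -2; 1; -1], [:: -8; -16; -8]); ([:: -2; 1; 0], [:: -4; -8; -4]);
  ([:: -2; 2; -2], [:: -1; -2; -1]); ([:: -2; 2; -1], [:: -2; -4; -2]);
  ([:: -2; 2; 0], [:: -1; -2; -1]); ([:: -1; -2; -1], [:: -4; -6; -2]);
  ([:: -1; -2; 0], [:: -8; -16; -8]); ([:: -1; -2; 1], [:: -2; -4; -2]);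
  ([:: -1; -1; -1], [:: -25; -73; -84]); ([:: -1; -1; 0], [:: -35; -70; -34]);
  ([:: -1; -1; 1], [:: -6; -15; -11]); ([:: -1; 0; -2], [:: 6; 24; 18]);
  ([:: -1; 0; -1], [:: -10; -44; -102]); ([:: -1; 0; 0], [:: -25; -44; 9]);
  ([:: -1; 0; 1], [:: -7; -13; -8]); ([:: -1; 1; -1], [:: -1; 5; 34]);
  ([:: -1; 1; 0], [:: 6; 16; 1]); ([:: -1; 1; 1], [:: -3; -6; -3]);
  ([:: 0; -2; -2], [:: 4; 8; 4]); ([:: 0; -2; -1], [:: -6; -10; -4]);
  ([:: 0; -2; 0], [:: -17; -34; -17]); ([:: 0; -2; 1], [:: -6; -12; -6]);
  ([:: 0; -2; 2], [:: -1; -2; -1]); ([:: 0; -1; -2], [:: 2; 4; 2]);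
  ([:: 0; -1; -1], [:: -42; -109; -144]); ([:: 0; -1; 0], [:: -51; -85; -53]);
  ([:: 0; -1; 1], [:: -5; 6; 21]); ([:: 0; -1; 2], [:: -2; -4; -2]);
  ([:: 0; 0; -2], [:: 24; 63; 39]); ([:: 0; 0; -1], [:: 38; 35; -79]);
  ([:: 0; 0; 1], [:: -13; -20; -2]); ([:: 0; 0; 2], [:: -1; -2; -1]);
  ([:: 0; 1; -2], [:: 6; 13; 7]); ([:: 0; 1; -1], [:: 13; 36; 51]);
  ([:: 0; 1; 0], [:: 16; 39; 14]); ([:: 0; 1; 1], [:: -1; -1]);
  ([:: 0; 2; -2], [:: 1; 2; 1]); ([:: 0; 2; -1], [:: 2; 4; 2]);
  ([:: 0; 2; 0], [:: 1; 2; 1]); ([:: 1; -2; -2], [:: 4; 8; 4]);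
  ([:: 1; -2; 0], [:: -4; -8; -4]); ([:: 1; -1; -1], [:: -17; -36; -60]);
  ([:: 1; -1; 0], [:: -8; 1; -11]); ([:: 1; -1; 1], [:: 9; 37; 40]);
  ([:: 1; 0; -2], [:: 13; 29; 16]); ([:: 1; 0; -1], [:: 40; 63; 15]);
  ([:: 1; 0; 0], [:: 25; 44; -9]); ([:: 1; 0; 1], [:: -2; 1; 10]);
  ([:: 1; 1; -2], [:: 2; 5; 3]); ([:: 1; 1; -1], [:: 6; 15; 9]);
  ([:: 1; 1; 0], [:: 6; 15; 9]); ([:: 1; 1; 1], [:: 2; 5; 3]);
  ([:: 2; -2; -2], [:: 1; 2; 1]); ([:: 2; -2; -1], [:: 4; 8; 4]);
  ([:: 2; -2; 0], [:: 6; 12; 6]); ([:: 2; -2; 1], [:: 4; 8; 4]);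
  ([:: 2; -2; 2], [:: 1; 2; 1]); ([:: 2; -1; -2], [:: 2; 4; 2]);
  ([:: 2; -1; -1], [:: 8; 16; 8]); ([:: 2; -1; 0], [:: 12; 24; 12]);
  ([:: 2; -1; 1], [:: 8; 16; 8]); ([:: 2; -1; 2], [:: 2; 4; 2]);
  ([:: 2; 0; -2], [:: 1; 2; 1]); ([:: 2; 0; -1], [:: 4; 8; 4]);
  ([:: 2; 0; 0], [:: 6; 12; 6]); ([:: 2; 0; 1], [:: 4; 8; 4]);
  ([:: 2; 0; 2], [:: 1; 2; 1])].

Definition cert_s7_2 : sparse := [::
  ([:: -1; -2; -2], [:: -2; -8; -6]); ([:: -1; -2; -1], [:: -5; -16; -13]);
  ([:: -1; -2; 0], [:: -4; -8; -4]); ([:: -1; -2; 1], [:: -1; -2; -1]);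
  ([:: -1; -1; 0], [:: 5; 11; 5]); ([:: -1; 0; -2], [:: 1; 4; 3]);
  ([:: -1; 0; -1], [:: 11; 50; 81]); ([:: -1; 0; 0], [:: 21; 44; 9]);
  ([:: -1; 0; 1], [:: 1; 2; 1]); ([:: -1; 1; -1], [:: 8; 42; 74]);
  ([:: -1; 1; 0], [:: 13; 29; 3]); ([:: -1; 2; -2], [:: 1; 4; 3]);
  ([:: -1; 2; -1], [:: 2; 8; 6]); ([:: -1; 2; 0], [:: 1; 4; 3]);
  ([:: 0; -2; -2], [:: -4; -12; -8]); ([:: 0; -2; -1], [:: -22; -48; -24]);
  ([:: 0; -2; 0], [:: -23; -40; -13]); ([:: 0; -2; 1], [:: -6; -16; -10]);
  ([:: 0; -2; 2], [:: -1; -2; -1]); ([:: 0; -1; -2], [:: 10; 24; 14]);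
  ([:: 0; -1; -1], [:: -17; -68; -59]); ([:: 0; -1; 0], [:: -27; -63; -56]);
  ([:: 0; -1; 1], [:: -18; -51; -30]); ([:: 0; 0; -2], [:: 13; 34; 21]);
  ([:: 0; 0; -1], [:: -13; -58; -46]); ([:: 0; 0; 0], [:: -2; -7; -27]);
  ([:: 0; 0; 1], [:: -11; -27; -10]); ([:: 0; 0; 2], [:: 1; 2; 1]);
  ([:: 0; 1; -1], [:: -16; -34; -9]); ([:: 0; 1; 0], [:: 3; 18; 17]);
  ([:: 0; 1; 1], [:: 1; 8; 10]); ([:: 0; 2; -2], [:: 1; 2; 1]);
  ([:: 0; 2; -1], [:: 2; 4; 2]); ([:: 0; 2; 0], [:: 1; 2; 1]);
  ([:: 1; -2; -2], [:: -2; -4; -2]); ([:: 1; -2; -1], [:: -7; -28; -21]);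
  ([:: 1; -2; 0], [:: -9; -40; -31]); ([:: 1; -2; 1], [:: -5; -20; -15]);
  ([:: 1; -2; 2], [:: -1; -4; -3]); ([:: 1; -1; -1], [:: -18; -77; -79]);
  ([:: 1; -1; 0], [:: -18; -68; -88]); ([:: 1; 0; -2], [:: 3; 7; 4]);
  ([:: 1; 0; -1], [:: -8; -40; -52]); ([:: 1; 0; 0], [:: -6; -19; -51]);
  ([:: 1; 0; 1], [:: 6; 23; 17]); ([:: 1; 0; 2], [:: 1; 4; 3]);
  ([:: 1; 1; -2], [:: 1; 3; 2]); ([:: 1; 1; -1], [:: 3; 9; 6]);
  ([:: 1; 1; 0], [:: 3; 9; 6]); ([:: 1; 1; 1], [:: 1; 3; 2])].

Definition cert_s7_3 : sparse := [::
  ([:: -1; -1; -2], [:: -3; -20; -33]); ([:: -1; -1; 0], [:: 4; 27; 41]);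
  ([:: -1; -1; 1], [:: 1; 7; 8]); ([:: -1; 0; -2], [:: -12; -48; -36]);
  ([:: -1; 0; 0], [:: 16; 57; 43]); ([:: -1; 0; 1], [:: 4; 9; 7]);
  ([:: -1; 1; -2], [:: -3; -16; -21]); ([:: -1; 1; 0], [:: 4; 18; 22]);
  ([:: -1; 1; 1], [:: 1; 2; 1]); ([:: 0; -2; -1], [:: 10; 22; 12]);
  ([:: 0; -2; 0], [:: 10; 22; 12]); ([:: 0; -1; -2], [:: -16; -42; -38]);
  ([:: 0; -1; -1], [:: -8; -37; -47]); ([:: 0; -1; 0], [:: -5; -19; -9]);
  ([:: 0; -1; 1], [:: -12; -20; 3]); ([:: 0; -1; 2], [:: 1; 4; 3]);
  ([:: 0; 0; -2], [:: -25; -47; -4]); ([:: 0; 0; -1], [:: -28; -66; -52]);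
  ([:: 0; 0; 0], [:: 0; -9; -27]); ([:: 0; 0; 1], [:: 4; 12; 22]);
  ([:: 0; 0; 2], [:: 1; 2; 1]); ([:: 0; 1; -2], [:: -3; -13; -16]);
  ([:: 0; 1; -1], [:: -23; -65; -41]); ([:: 0; 1; 0], [:: -19; -47; -18]);
  ([:: 0; 1; 1], [:: 1; 5; 7]); ([:: 1; -1; -2], [:: -3; -20; -17]);
  ([:: 1; -1; -1], [:: -8; -52; -61]); ([:: 1; -1; 0], [:: -6; -38; -53]);
  ([:: 1; -1; 2], [:: 1; 6; 9]); ([:: 1; 0; -2], [:: -3; -2; 2]);
  ([:: 1; 0; 0], [:: 10; 10; -12]); ([:: 1; 0; 1], [:: 8; 12; -7]);
  ([:: 1; 0; 2], [:: 1; 4; 3])].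

Definition cert_s10 : sparse := [::
  ([:: -2; -2; -2], [:: -1; -2; -1]); ([:: -2; -2; -1], [:: -5; -12; -7]);
  ([:: -2; -2; 0], [:: -3; -6; -3]); ([:: -2; -1; -1], [:: -7; -22; -19]);
  ([:: -2; -1; 0], [:: -6; -12; -6]); ([:: -2; 0; -1], [:: -3; -12; -9]);
  ([:: -2; 0; 0], [:: -3; -6; -3]); ([:: -1; -1; -1], [:: -4; -16; -18]);
  ([:: -1; -1; 0], [:: -14; -36; -16]); ([:: -1; -1; 1], [:: -6; -14; -8]);
  ([:: -1; 0; 0], [:: -14; -44; -56]); ([:: -1; 0; 1], [:: -11; -26; -11]);
  ([:: -1; 1; 0], [:: -3; -16; -29]); ([:: -1; 1; 1], [:: -4; -10; -6]);
  ([:: 0; -2; -2], [:: 1; 2; 1]); ([:: 0; -2; -1], [:: 5; 12; 7]);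
  ([:: 0; -2; 0], [:: 3; 6; 3]); ([:: 0; -1; -1], [:: 7; 16; 7]);
  ([:: 0; -1; 0], [:: 3; 2; 1]); ([:: 0; 0; -1], [:: 6; 28; 38]);
  ([:: 0; 0; 1], [:: -3; -2; -1]); ([:: 0; 0; 2], [:: -3; -6; -3]);
  ([:: 0; 1; 0], [:: -6; -28; -38]); ([:: 0; 1; 1], [:: -7; -16; -7]);
  ([:: 0; 1; 2], [:: -5; -12; -7]); ([:: 0; 2; 2], [:: -1; -2; -1]);
  ([:: 1; -1; -1], [:: 4; 10; 6]); ([:: 1; -1; 0], [:: 11; 26; 11]);
  ([:: 1; -1; 1], [:: 6; 14; 8]); ([:: 1; 0; -1], [:: 3; 16; 29]);
  ([:: 1; 0; 0], [:: 14; 44; 56]); ([:: 1; 0; 1], [:: 14; 36; 16]);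
  ([:: 1; 1; 1], [:: 4; 16; 18]); ([:: 2; 0; 0], [:: 3; 6; 3]);
  ([:: 2; 0; 1], [:: 6; 12; 6]); ([:: 2; 0; 2], [:: 3; 6; 3]);
  ([:: 2; 1; 0], [:: 3; 12; 9]); ([:: 2; 1; 1], [:: 7; 22; 19]);
  ([:: 2; 1; 2], [:: 5; 12; 7]); ([:: 2; 2; 2], [:: 1; 2; 1])].

Definition cert_s18 : sparse := [::
  ([:: -2; -2; 0], [:: -4; -9; -5]); ([:: -2; -2; 1], [:: 8; 16; 8]);
  ([:: -2; -2; 2], [:: -12; -24; -12]); ([:: -2; -2; 3], [:: 8; 16; 8]);
  ([:: -2; -2; 4], [:: -4; -8; -4]); ([:: -2; -1; -1], [:: -4; -10; -6]);
  ([:: -2; -1; 0], [:: 12; 26; 21]); ([:: -2; -1; 1], [:: -4; -16; -24]);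
  ([:: -2; -1; 2], [:: -8; -16; -8]); ([:: -2; -1; 3], [:: 16; 32; 16]);
  ([:: -2; -1; 4], [:: -8; -16; -8]); ([:: -2; 0; -2], [:: 0; 1; 1]);
  ([:: -2; 0; -1], [:: 8; 26; 13]); ([:: -2; 0; 0], [:: 0; 4; 12]);
  ([:: -2; 0; 1], [:: -5; -13; -4]); ([:: -2; 0; 2], [:: 6; -8; -14]);
  ([:: -2; 0; 3], [:: 16; 32; 16]); ([:: -2; 1; -1], [:: -4; -14; -6]);
  ([:: -2; 1; 0], [:: -7; -13; -14]); ([:: -2; 1; 1], [:: -10; -14; -2]);
  ([:: -2; 1; 2], [:: -12; -14; -2]); ([:: -2; 1; 3], [:: 6; 16; 10]);
  ([:: -2; 2; -1], [:: -4; -16; -12]); ([:: -2; 2; 0], [:: -2; 8; 10]);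
  ([:: -2; 2; 1], [:: -6; -24; -18]); ([:: -2; 2; 2], [:: -10; -16; -6]);
  ([:: -2; 3; -1], [:: 8; 32; 24]); ([:: -2; 3; 0], [:: 14; 32; 18]);
  ([:: -2; 3; 1], [:: 10; 14; 4]); ([:: -2; 4; -1], [:: -4; -16; -12]);
  ([:: -2; 4; 0], [:: -4; -8; -4]); ([:: -1; -2; -1], [:: -4; -11; -7]);
  ([:: -1; -2; 0], [:: 5; 17; 12]); ([:: -1; -2; 1], [:: -2; -8; -6]);
  ([:: -1; -1; -2], [:: 0; -1; -1]); ([:: -1; -1; -1], [:: 8; 30; 26]);
  ([:: -1; -1; 0], [:: 9; 50; 263]); ([:: -1; -1; 1], [:: -17; -113; -182]);
  ([:: -1; -1; 2], [:: 34; 138; 80]); ([:: -1; -1; 3], [:: 2; -56; -132]);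
  ([:: -1; -1; 4], [:: 0; -8; -8]); ([:: -1; 0; -2], [:: 3; 5; 2]);
  ([:: -1; 0; -1], [:: 17; -38; -325]); ([:: -1; 0; 0], [:: -42; -116; 118]);
  ([:: -1; 0; 1], [:: -34; 104; 378]); ([:: -1; 0; 2], [:: 50; -14; 232]);
  ([:: -1; 0; 3], [:: 66; 254; 234]); ([:: -1; 1; -1], [:: -33; -41; 190]);
  ([:: -1; 1; 0], [:: 0; 0; -352]); ([:: -1; 1; 1], [:: -30; 14]);
  ([:: -1; 1; 2], [:: -16; -16; 92]); ([:: -1; 2; 0], [:: -18; 92; -98]);
  ([:: -1; 3; 0], [:: -60; -314; -374]); ([:: -1; 4; -1], [:: -8; -24; -16]);
  ([:: 0; -2; -1], [:: 4; 11; 7]); ([:: 0; -2; 0], [:: -5; -8; -3]);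
  ([:: 0; -2; 1], [:: 23; 43; 20]); ([:: 0; -2; 2], [:: -10; -20; -10]);
  ([:: 0; -2; 3], [:: -2; -4; -2]); ([:: 0; -2; 4], [:: 4; 8; 4]);
  ([:: 0; -1; -2], [:: 0; 1; 1]); ([:: 0; -1; -1], [:: 0; -10; -22]);
  ([:: 0; -1; 0], [:: -12; -60; 108]); ([:: 0; -1; 1], [:: 44; 94; -374]);
  ([:: 0; -1; 2], [:: -12; -22; -62]); ([:: 0; -1; 3], [:: 0; -66; -140]);
  ([:: 0; 0; -2], [:: -1; -2; -1]); ([:: 0; 0; -1], [:: -18; -76; -114]);
  ([:: 0; 0; 0], [:: -20; 60; -40]); ([:: 0; 0; 1], [:: 73; 147; -242]);
  ([:: 0; 0; 2], [:: 44; 198; 358]); ([:: 0; 1; -2], [:: -5; -9; -4]);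
  ([:: 0; 1; -1], [:: -18; -4; 350]); ([:: 0; 1; 0], [:: 11; 383; -8]);
  ([:: 0; 1; 1], [:: 20; 60; -90]); ([:: 0; 2; -1], [:: 4; 98; 214]);
  ([:: 0; 2; 0], [:: -56; -156; -80]); ([:: 0; 3; -2], [:: 2; 4; 2]);
  ([:: 0; 3; -1], [:: -6; -24; -18]); ([:: 1; -2; -1], [:: -4; -12; -8]);
  ([:: 1; -2; 0], [:: 4; 10; 6]); ([:: 1; -2; 1], [:: 3; 7; 4]);
  ([:: 1; -2; 2], [:: -8; -16; -8]); ([:: 1; -2; 3], [:: -2; -4; -2]);
  ([:: 1; -1; -1], [:: -4; -14; -74]); ([:: 1; -1; 0], [:: 12; 130; 346]);
  ([:: 1; -1; 1], [:: -11; -77; -240]); ([:: 1; -1; 2], [:: -10; 10; 112]);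
  ([:: 1; 0; -2], [:: 0; -2; -2]); ([:: 1; 0; -1], [:: 34; 10; -356]);
  ([:: 1; 0; 0], [:: 48; 124; -132]); ([:: 1; 0; 1], [:: 78; 250; -4]);
  ([:: 1; 1; -2], [:: -1; -1]); ([:: 1; 1; -1], [:: 17; 155; 244]);
  ([:: 1; 1; 0], [:: -36; -88; -136]); ([:: 1; 2; -2], [:: 2; 4; 2]);
  ([:: 1; 2; -1], [:: 2; 62; 60]); ([:: 2; -2; 0], [:: -8; -16; -8]);
  ([:: 2; -2; 2], [:: 4; 8; 4]); ([:: 2; -1; -1], [:: 4; 32; 102]);
  ([:: 2; -1; 0], [:: -16; -44; 206]); ([:: 2; 0; 0], [:: -12; -64; 60]);
  ([:: 2; 1; -1], [:: -10; -58; 44]); ([:: 3; -1; -1], [:: -4; -26; -96]);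
  ([:: 3; -1; 0], [:: -2; 48; 96]); ([:: 3; 0; -1], [:: -4; -86; -202]);
  ([:: 4; -2; 0], [:: 2; 4; 2])].

(** The number D of the certificate, by which the recurrence is multiplied so that the P_i have
    integer coefficients. *)
Definition multiplier (s : sporadic) : Z :=
  match s with
  | seqB => 2
  | seqF => 2
  | seq_delta => 4
  | seq_eta => 57960
  | seq_epsilon => 3
  | seq_gamma => 36
  | seq_s10 => 3
  | seq_s18 => 4
  | _ => 1
  end.

Definition certificates (s : sporadic) : seq sparse :=
  match s with
  | seqA => [:: cert_A_1; cert_A_2]
  | seqB => [:: cert_B_1; cert_B_2]
  | seqC => [:: cert_C_1; cert_C_2]
  | seqD => [:: cert_D_1; cert_D_2]
  | seqE => [:: cert_E_1; cert_E_2]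
  | seqF => [:: cert_F_1; cert_F_2]
  | seq_delta => [:: cert_delta_1; cert_delta_2; cert_delta_3]
  | seq_eta => cyclic cert_eta
  | seq_alpha => cyclic cert_alpha
  | seq_epsilon => cyclic cert_epsilon
  | seq_zeta => cyclic cert_zeta
  | seq_gamma => [:: cert_gamma_1; cert_gamma_2; cert_gamma_3]
  | seq_s7 => [:: cert_s7_1; cert_s7_2; cert_s7_3]
  | seq_s10 => cyclic cert_s10
  | seq_s18 => cyclic cert_s18
  end.

(** Where e_i or - e_i is not in the support, a multiple of it is a sum of support points, such as
    (3, 0) = (-1, 2) + 2 (2, -1) for [seqB]. *)
Definition axis_points (s : sporadic) : seq (seq (seq Z)) :=
  match s with
  | seqA | seqC | seqD | seqF =>
    [:: [:: [:: 1; 0]];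
        [:: [:: 0; 1]];
        [:: [:: -1; 0]];
        [:: [:: 0; -1]]]
  | seqB =>
    [:: [:: [:: -1; 2]; [:: 2; -1]; [:: 2; -1]];
        [:: [:: -1; 2]; [:: -1; 2]; [:: 2; -1]];
        [:: [:: -1; -1]; [:: -1; -1]; [:: -1; 2]];
        [:: [:: -1; -1]; [:: -1; -1]; [:: 2; -1]]]
  | seqE =>
    [:: [:: [:: 1; -1]; [:: 1; 1]];
        [:: [:: -1; 1]; [:: 1; 1]];
        [:: [:: -1; -1]; [:: -1; 1]];
        [:: [:: -1; -1]; [:: 1; -1]]]
  | seq_delta | seq_alpha | seq_epsilon | seq_zeta | seq_gamma
  | seq_s7 | seq_s10 | seq_s18 =>
    [:: [:: [:: 1; 0; 0]];
        [:: [:: 0; 1; 0]];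
        [:: [:: 0; 0; 1]];
        [:: [:: -1; 0; 0]];
        [:: [:: 0; -1; 0]];
        [:: [:: 0; 0; -1]]]
  | seq_eta => [::]
  end.

(** Where a coordinate exceeds 1 on the polytope, it is split into functionals that do not: for the
    triangle x >= -1, y >= -1, x + y <= 1 of [seqB], (1, 0) = (0, -1) + (1, 1). *)
Definition axis_functionals (s : sporadic) : seq (seq (seq Z)) :=
  match s with
  | seqA | seqC | seqD | seqE =>
    [:: [:: [:: 1; 0]];
        [:: [:: 0; 1]];
        [:: [:: -1; 0]];
        [:: [:: 0; -1]]]
  | seqB | seqF =>
    [:: [:: [:: 0; -1]; [:: 1; 1]];
        [:: [:: -1; 0]; [:: 1; 1]];
        [:: [:: -1; 0]];
        [:: [:: 0; -1]]]
  | seq_delta =>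
    [:: [:: [:: 1; 0; 0]];
        [:: [:: -1; 0; 0]; [:: 1; 1; 0]];
        [:: [:: -1; 0; 0]; [:: 1; 0; 1]];
        [:: [:: -1; 0; 0]];
        [:: [:: 0; -1; 0]];
        [:: [:: 0; 0; -1]]]
  | seq_alpha | seq_epsilon | seq_zeta | seq_s7 | seq_s10 =>
    [:: [:: [:: 1; 0; 0]];
        [:: [:: 0; 1; 0]];
        [:: [:: 0; 0; 1]];
        [:: [:: -1; 0; 0]];
        [:: [:: 0; -1; 0]];
        [:: [:: 0; 0; -1]]]
  | seq_gamma =>
    [:: [:: [:: 1; 0; 0]];
        [:: [:: -1; 0; 0]; [:: 1; 1; 0]];
        [:: [:: -1; -1; 0]; [:: 1; 1; 1]];
        [:: [:: -1; 0; 0]];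
        [:: [:: 0; -1; 0]];
        [:: [:: 0; 0; -1]]]
  | seq_s18 =>
    [:: [:: [:: 0; -1; 0]; [:: 0; 0; -1]; [:: 1; 1; 1]];
        [:: [:: -1; 0; 0]; [:: 0; 0; -1]; [:: 1; 1; 1]];
        [:: [:: -1; 0; 0]; [:: 0; -1; 0]; [:: 1; 1; 1]];
        [:: [:: -1; 0; 0]];
        [:: [:: 0; -1; 0]];
        [:: [:: 0; 0; -1]]]
  | seq_eta => [::]
  end.

End Data.

(** * Running the checks, and conclusion *)

Definition signs_check (k : nat) (g : sparse) : bool :=
  all (fun t => if coefsp k t.1 g is [:: c] then Z.eqb (Z.abs c) (Zpos 1)
                else false) g.

Lemma signs_checkP k (g : sparse) : signs_check k g ->
  forall a, (laurent_of (laurent_model k) 0 g : laurent k)@_a \in [:: -1; 0; 1].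
Proof.
move=> /allP gP a; set f : laurent k := laurent_of (laurent_model k) 0 g.
have [-> //|] := eqVneq f@_a 0.
rewrite -[f@_a]/(coeff (l := laurent_model k) f a).
move=> /laurent_of_support[t /gP tg <-]; rewrite coeff_laurent_of.
case: coefsp tg => [//|z [|//]] /=; rewrite mul0r addr0.
by case: z => [|[]|[]].
Qed.

Definition representation_check (s : sporadic) (L : sparse) (D : Z)
    (P : seq sparse) : bool :=
  let r := sporadic_recurrence s in
  [&& ~~ Z.eqb D Z0, scalarsp L, initial_check (nvars s) r L
    & certificate (nvars s) r L D P].

Lemma representation_checkP s L D P u :
  is_sporadic s u -> representation_check s L D P ->
  represents (laurent_of (laurent_model (nvars s)) 0 L : laurent (nvars s)) u.
Proof.
move=> /sporadic_rat_satisfies[u0 ru] /and4P[D0 Lscal init cert] n _.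
have D_neq0 : D <> Z0 by move=> DE; rewrite DE in D0.
pose M := laurent_model (nvars s).
(* In [laurent_model] the abstract [ct] unfolds to [CT], so the result on the abstract ring applies
   by conversion. *)
exact: (@satisfies_unique _ u (fun m => ct (laurent_of M 0 L ^+ m))
  (sporadic_up_neq0 s) u0 ru (ct1 M)
  (ct_exp_recurrence M D_neq0 Lscal init cert)).
Qed.

(** For [seqF] the product of the factors has the doubled polytope, with interior lattice points
    besides 0; [laurent_F] avoids this. *)
Definition certificate_poly (s : sporadic) : sparse :=
  if s is seqF then laurent_F else prodsp (factors s).

Lemma certificate_polyE s :
  s <> seqF -> certificate_poly s = prodsp (factors s).
Proof. by case: s. Qed.

Lemma factors_check s : all (signs_check (nvars s)) (factors s).
Proof. by case: s; vm_compute. Qed.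

Lemma polytope_check_sporadic s : s <> seq_eta ->
  polytope_check (nvars s) (certificate_poly s)
    (axis_points s) (axis_functionals s).
Proof. by case: s => // _; vm_compute. Qed.

Lemma representation_check_sporadic s :
  representation_check s (certificate_poly s) (multiplier s) (certificates s).
Proof. by case: s; vm_compute. Qed.

(** Applied to P(x^2, y^2), theta_i gives twice the value of theta_i(P) at (x^2, y^2), and likewise
    for L. Substitution thus turns a certificate for L into one for L(x^2, y^2) with D doubled. *)
Lemma representation_check_F :
  representation_check seqF (prodsp factors_F)
    (Z.mul (Zpos 2) (multiplier seqF)) (map squaresp (certificates seqF)).
Proof. by vm_compute. Qed.

Lemma represents_factors s u : is_sporadic s u ->
  represents (laurent_of (laurent_model (nvars s)) 0 (prodsp (factors s))
              : laurent (nvars s)) u.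
Proof.
move=> su; have [sF|/certificate_polyE <-] : s = seqF \/ s <> seqF.
- by case: (s); (by left) || (by right).
- by rewrite sF in su *; exact: representation_checkP su representation_check_F.
- exact: representation_checkP su (representation_check_sporadic s).
Qed.

Theorem theorem1p1 (R : realType) (s : sporadic) (u : nat -> rat)
    (hu : is_sporadic s u) :
  (exists f : laurent (nvars s), represents f u)
  /\ (exists f : laurent (nvars s),
        represents f u /\
        exists fs : seq (laurent (nvars s)),
          f = \prod_(g <- fs) g /\
          forall g : laurent (nvars s), g \in fs ->
          forall a : 'rV[int]_(nvars s), g@_a \in [:: -1; 0; 1])
  /\ (s <> seq_eta ->
        exists f : laurent (nvars s),
          represents f u /\ origin_only_interior_point R f).
Proof.
pose M := laurent_model (nvars s); have rep := represents_factors hu.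
split; first by exists (laurent_of M 0 (prodsp (factors s))).
split=> [|s_eta].
  exists (laurent_of M 0 (prodsp (factors s))); split=> //.
  exists [seq (laurent_of M 0 g : laurent (nvars s)) | g <- factors s].
  rewrite big_map laurent_of_prod; split=> // _ /mapP[g gs ->].
  exact: signs_checkP (allP (factors_check s) g gs).
exists (laurent_of M 0 (certificate_poly s)); split.
  exact: representation_checkP hu (representation_check_sporadic s).
by apply: polytope_checkP (polytope_check_sporadic s_eta); case: (s).
Qed.
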